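(* Let $P=\mathcal N(0,\Sigma)$ on $\mathbb R^D$ with $\Sigma$ a (strictly) positive definite $D\times D$ matrix. Let $Q=\mathcal N(0,AVA^{T})$ be a degenerate Gaussian, where $A$ is a $D\times K$ matrix with orthonormal columns and $V$ is a $K\times K$ (strictly) positive definite diagonal matrix. Then $$\mathrm{QKL}(Q\|P)=c-\frac12\sum_{k=1}^K\log V_{kk}+\frac12\operatorname{Tr}\left(A^T\Sigma^{-1}AV\right),$$ where $c$ does not depend on $A$ and $V$. Moreover, $\mathrm{QKL}(Q\|P)$ is minimised over all such $(A,V)$ by taking the columns of $A$ to be the top $K$ eigenvectors of $\Sigma$ (orthonormal eigenvectors belonging to the $K$ largest eigenvalues) and the diagonal of $V$ to be the corresponding eigenvalues.
   Context: For $Q$ supported on a linear subspace $S\subset\mathbb R^D$ with density $q$ with respect to the Lebesgue measure on $S$, and $P$ with continuous density $p$ with respect to Lebesgue measure on $\mathbb R^D$, the Quasi-KL divergence is $\mathrm{QKL}(Q\|P):=\mathbb E_Q\left(\log\frac qp\right)=\int_S q\log\frac{q}{p}\,dm_S$, where $m_S$ is the Lebesgue measure on $S$. Here $S$ is the column space of $A$, whose Lebesgue measure is the image of Lebesgue measure on $\mathbb R^K$ under $z\mapsto Az$. *)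

(* Defs.v *)
From HB Require Import structures.
From mathcomp Require Import all_boot all_order all_algebra.
From mathcomp Require Import all_classical all_reals all_analysis.

Set Implicit Arguments.
Unset Strict Implicit.
Unset Printing Implicit Defensive.
Import Order.TTheory GRing.Theory Num.Theory.
Import numFieldNormedType.Exports.
Local Open Scope classical_set_scope.
Local Open Scope ring_scope.

(* Real matrices carry the Borel sigma-algebra, presented as the product
   sigma-algebra generated by the coordinates. *)
Definition mx_display : measure_display.
Proof. exact: default_measure_display. Qed.

Section measurable_matrix.
Context {R : realType} (m n : nat).

Definition mx_cylinder : set (set 'M[R]_(m, n)) :=
  [set (fun M : 'M[R]_(m, n) => M ij.1 ij.2) @^-1` B
    | ij in [set: 'I_m * 'I_n] & B in @measurable _ R].

Let mx_set0 : <<s mx_cylinder >> set0.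
Proof. exact: sigma_algebra0. Qed.

Let mx_setC A : <<s mx_cylinder >> A -> <<s mx_cylinder >> (~` A).
Proof. exact: sigma_algebraC. Qed.

Let mx_bigcup (F : _^nat) : (forall i, <<s mx_cylinder >> (F i)) ->
  <<s mx_cylinder >> (\bigcup_i (F i)).
Proof. exact: sigma_algebra_bigcup. Qed.

HB.instance Definition _ := @isMeasurable.Build mx_display
  'M[R]_(m, n) <<s mx_cylinder >> mx_set0 mx_setC mx_bigcup.

End measurable_matrix.

Lemma measurable_coord (R : realType) m n (i : 'I_m) (j : 'I_n) :
  measurable_fun [set: 'M[R]_(m, n)] (fun M => M i j).
Proof.
move=> _ B mB; rewrite setTI; apply: sub_sigma_algebra.
by exists (i, j) => //; exists B.
Qed.

Lemma measurable_fun_mx d (T : measurableType d) (R : realType)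
    m n (f : T -> 'M[R]_(m, n)) :
  (forall i j, measurable_fun [set: T] (fun x => f x i j)) ->
  measurable_fun [set: T] f.
Proof.
move=> mf; apply: (@measurability _ _ _ _ _ _ (@mx_cylinder R m n)) => //.
move=> _ [_ [[i j] _ [B mB <-]] <-].
exact: (mf i j).
Qed.

Section power_measure.
Context {R : realType}.
Local Notation RM := (measurableTypeR R).
Variable m : {sigma_finite_measure set (measurableTypeR R) -> \bar R}.

Definition cv_cons n (xv : RM * 'cV[R]_n) : 'cV[R]_n.+1 :=
  \col_i oapp (fun j => xv.2 j 0) (xv.1 : R) (unlift ord0 i).

Definition cv_uncons n (w : 'cV[R]_n.+1) : RM * 'cV[R]_n :=
  (w 0 0, \col_i w (lift ord0 i) 0).

Lemma cv_consK n : cancel (@cv_cons n) (@cv_uncons n).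
Proof.
move=> [x v]; rewrite /cv_uncons mxE unlift_none /=; congr pair.
by apply/colP => i; rewrite !mxE liftK.
Qed.

Lemma cv_unconsK n : cancel (@cv_uncons n) (@cv_cons n).
Proof.
move=> w; apply/colP => i; rewrite mxE.
by case: unliftP => [j|] -> /=; rewrite ?mxE.
Qed.

Lemma measurable_cv_cons n : measurable_fun setT (@cv_cons n).
Proof.
apply: measurable_fun_mx => i j.
under eq_fun do rewrite mxE.
case: unliftP => [k|] _ /=; last exact: measurable_fst.
apply: (@measurableT_comp _ _ _ _ _ _ (fun M : 'cV[R]_n => M k 0)).
  exact: measurable_coord.
exact: measurable_snd.
Qed.

Lemma measurable_cv_uncons n : measurable_fun setT (@cv_uncons n).
Proof.
apply: measurable_fun_pair; first exact: measurable_coord.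
apply: measurable_fun_mx => i j.
under eq_fun do rewrite mxE.
exact: measurable_coord.
Qed.

Section step.
Variables (n : nat) (mn : {sigma_finite_measure set 'cV[R]_n -> \bar R}).

Definition power_step : set 'cV[R]_n.+1 -> \bar R :=
  pushforward (m \x mn)%E (@cv_cons n).

Let mf := @measurable_cv_cons n.

Let power0 : power_step set0 = 0%E.
Proof. by rewrite /power_step /pushforward preimage_set0 measure0. Qed.

Let power_ge0 A : (0 <= power_step A)%E.
Proof. exact: measure_ge0. Qed.

Let power_sigma_additive : semi_sigma_additive power_step.
Proof.
move=> F mF tF mUF; rewrite /power_step /pushforward preimage_bigcup.
apply: measure_semi_sigma_additive.
- by move=> k; rewrite -[X in measurable X]setTI; exact: mf.
- by apply/trivIsetP => i j _ _ ij; rewrite -preimage_setI;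
    move/trivIsetP : tF => /(_ _ _ I I ij) ->; rewrite preimage_set0.
- by rewrite -preimage_bigcup -[X in measurable X]setTI; exact: mf.
Qed.

HB.instance Definition _ := isMeasure.Build _ _ _ power_step
  (power0) (power_ge0) (power_sigma_additive).

Let power_step_sigma_finite : sigma_finite setT power_step.
Proof.
have /sigma_finiteP[F [TF ndF Foo]] := sigma_finiteT m.
have /sigma_finiteP[G [TG ndG Goo]] := sigma_finiteT mn.
exists (fun k => @cv_uncons n @^-1` (F k `*` G k)).
  apply/seteqP; split => // w _.
  have [i _ Fi] : (\bigcup_i F i) (cv_uncons w).1 by rewrite -TF.
  have [j _ Gj] : (\bigcup_i G i) (cv_uncons w).2 by rewrite -TG.
  exists (maxn i j) => //; split.
    by move: Fi; exact/subsetPset/ndF/leq_maxl.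
  by move: Gj; exact/subsetPset/ndG/leq_maxr.
move=> k; have [mF Fk] := Foo k; have [mG Gk] := Goo k; split.
  rewrite -[X in measurable X]setTI; apply: measurable_cv_uncons => //.
  exact: measurableX.
rewrite /power_step /pushforward (_ : _ @^-1` _ = F k `*` G k).
  by rewrite product_measure1E// lte_mul_pinfty// ge0_fin_numE.
by apply/seteqP; split => x; rewrite /preimage /mkset cv_consK.
Qed.

HB.instance Definition _ := Measure_isSigmaFinite.Build _ _ _ power_step
  power_step_sigma_finite.
End step.

(* The n-fold product of m with itself. *)
Fixpoint power_measure n : {sigma_finite_measure set 'cV[R]_n -> \bar R} :=
  if n is n'.+1 return {sigma_finite_measure set 'cV[R]_n -> \bar R}
  then power_step (power_measure n') else dirac (0 : 'cV[R]_0).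

End power_measure.


Section gaussian.
Context {R : realType}.

Definition lebesgue_cv n : {sigma_finite_measure set 'cV[R]_n -> \bar R} :=
  power_measure (@lebesgue_measure R) n.

Definition std_gaussian n : {sigma_finite_measure set 'cV[R]_n -> \bar R} :=
  power_measure (normal_prob 0 1) n.

(* mu = N(0, Gamma), possibly degenerate: the law of B Z for a standard normal
   vector Z and some B with B B^T = Gamma. *)
Definition is_gaussian D (mu : probability 'cV[R]_D R) (Gamma : 'M[R]_D) :=
  exists l (B : 'M[R]_(D, l)), Gamma = B *m B^T /\
    forall E, measurable E -> mu E = pushforward (std_gaussian l) (mulmx B) E.

Definition is_density D (lam mu : set 'cV[R]_D -> \bar R) (f : 'cV[R]_D -> R) :=
  [/\ measurable_fun setT f, forall x, 0 <= f x &
      forall E, measurable E -> mu E = (\int[lam]_(x in E) (f x)%:E)%E].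

Definition col_space D K (A : 'M[R]_(D, K)) : set 'cV[R]_D :=
  range (fun z : 'cV[R]_K => A *m z).

(* Lebesgue measure on the column space of A, for A with orthonormal columns. *)
Definition lebesgue_col_space D K (A : 'M[R]_(D, K)) : set 'cV[R]_D -> \bar R :=
  pushforward (lebesgue_cv K) (mulmx A).

(* The density q is determined only up to a null set of the column space, which
   the integral does not see, so any choice will do; the continuous density p is
   unique. Both are arbitrary functions if no such density exists. *)
Definition subspace_density D K (A : 'M[R]_(D, K)) (Q : probability 'cV[R]_D R)
  : 'cV[R]_D -> R := get (is_density (lebesgue_col_space A) Q).

Definition continuous_density D (P : probability 'cV[R]_D R) : 'cV[R]_D -> R :=
  get [set p | continuous p /\ is_density (lebesgue_cv D) P p].

(* QKL(Q || P) for Q supported on the column space of A. Taking the quotient and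
   the logarithm in the extended reals gives 0 where q = 0 and +oo where
   p = 0 < q. *)
Definition qkl D K (A : 'M[R]_(D, K)) (Q P : probability 'cV[R]_D R) : \bar R :=
  let q := subspace_density A Q in let p := continuous_density P in
  (\int[lebesgue_col_space A]_(x in col_space A)
     ((q x)%:E * lne ((q x)%:E / (p x)%:E)))%E.

Definition posdef n (M : 'M[R]_n) :=
  M^T = M /\ forall x : 'cV[R]_n, x != 0 -> 0 < (x^T *m M *m x) 0 0.

Definition admissible D K (A : 'M[R]_(D, K)) (V : 'M[R]_K) :=
  [/\ A^T *m A = 1%:M, is_diag_mx V & posdef V].

(* The sequence s lists all the eigenvalues of S with multiplicity. *)
Definition top_eigenvectors D K (S : 'M[R]_D) (A : 'M[R]_(D, K)) (e : 'rV[R]_K) :=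
  [/\ A^T *m A = 1%:M,
      forall k, S *m col k A = e 0 k *: col k A &
      exists s : seq R,
        [/\ char_poly S = \prod_(x <- s) ('X - x%:P), sorted >=%R s &
            perm_eq [seq e 0 k | k : 'I_K] (take K s)]].

End gaussian.

(* Main.v *)
(* Rotation invariance of the standard normal law reduces every N(0, A V A^T) to
   the law of A V^(1/2) Z with Z a standard normal vector in R^K, whatever
   factor B with B B^T = A V A^T presents it; the density of Q on the column
   space and the continuous density of P are then explicit, and QKL is an
   expectation of quadratic forms in Z.

   For the minimum, write Sigma = sum_i x_i u_i u_i^T with x_1 >= ... >= x_D,
   and w_ki = <u_i, a_k>^2. Since sum_i w_ki = 1, twice the objective is, up to
   a constant, sum_ki w_ki (V_kk / x_i - ln V_kk) >= sum_ki w_ki (1 - ln x_i).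
   The weights t_i = sum_k w_ki lie in [0, 1] and sum to K, so the last sum is at
   least K - ln x_1 - ... - ln x_K, with equality for the top eigenvectors. *)
Require Import Defs.
From mathcomp Require Import all_boot all_order all_algebra.
From mathcomp Require Import fingroup perm complex ring lra zify.
From mathcomp Require Import all_classical all_reals all_analysis.
From mathcomp Require Import measurable_realfun.

Set Implicit Arguments.
Unset Strict Implicit.
Unset Printing Implicit Defensive.
Import Order.TTheory GRing.Theory Num.Theory.
Import numFieldNormedType.Exports.
Local Open Scope classical_set_scope.
Local Open Scope ring_scope.

(** * Real spectral theorem *)

(** Two obstacles shape the proof. First, [is_gaussian] allows a factor [B] with any number of
    columns. It is written as [C *m W], where [C] is an explicit factor with a left inverse and [W]
    has orthonormal rows; such a [W] sends standard normal vectors to standard normal vectors, so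
    the law depends on [C] alone. Second, linear changes of variables are made without Jacobians:
    translation invariance and Tonelli show that an invertible matrix multiplies every Lebesgue
    integral by one constant, and that constant is read off from a Gaussian density, whose integral
    is known. The densities inside [qkl] are chosen by [get]: [q] is exchanged for the explicit
    density by almost everywhere uniqueness, while [p] is identified exactly, because continuous
    functions that agree almost everywhere agree. *)

Section householder.
Context {R : rcfType}.

Lemma sqnorm_cvE n (v : 'cV[R]_n) : (v^T *m v) 0 0 = \sum_i v i 0 ^+ 2.
Proof. by rewrite mxE; apply: eq_bigr => i _; rewrite mxE expr2. Qed.

Lemma sqnorm_cv_ge0 n (v : 'cV[R]_n) : 0 <= (v^T *m v) 0 0.
Proof. by rewrite sqnorm_cvE sumr_ge0// => i _; rewrite sqr_ge0. Qed.

Lemma sqnorm_cv_eq0 n (v : 'cV[R]_n) : ((v^T *m v) 0 0 == 0) = (v == 0).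
Proof.
rewrite sqnorm_cvE psumr_eq0; last by move=> i _; rewrite sqr_ge0.
apply/allP/eqP => [v0|-> i _]; last by rewrite /= mxE expr0n eqxx.
apply/colP => i; rewrite mxE; apply/eqP; rewrite -sqrf_eq0.
exact: (v0 i (mem_index_enum i)).
Qed.

(* The reflection exchanging [u] and [v] when they are distinct. *)
Definition householder n (u v : 'cV[R]_n) : 'M[R]_n :=
  1%:M - (2 / ((u - v)^T *m (u - v)) 0 0) *: ((u - v) *m (u - v)^T).

Lemma householderT n (u v : 'cV[R]_n) : (householder u v)^T = householder u v.
Proof.
by rewrite /householder linearB/= linearZ/= trmx1 trmx_mul trmxK.
Qed.

Lemma householderK n (u v : 'cV[R]_n) :
  householder u v *m householder u v = 1%:M.
Proof.
rewrite /householder; set w := u - v; set q := (w^T *m w) 0 0.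
rewrite mulmxBl mul1mx mulmxBr mulmx1 -scalemxAl -scalemxAr.
rewrite mulmxA -(mulmxA w) [w^T *m w]mx11_scalar -/q mul_mx_scalar.
rewrite -scalemxAl !scalerA.
(* If [u = v], the rank-one term vanishes and the reflection is the identity. *)
have [w0|q0] := eqVneq w 0.
  by rewrite w0 !mul0mx !scaler0 !subr0.
have {}q0 : q != 0 by rewrite sqnorm_cv_eq0.
rewrite -addrA -opprD addrA -scalerDl.
by rewrite divfK// -scalerBl mulr_natr mulr2n subrr scale0r subr0.
Qed.

Lemma householder_swap n (u v : 'cV[R]_n) :
  u^T *m u = v^T *m v -> householder u v *m u = v.
Proof.
move=> uv; rewrite /householder; set w := u - v; set q := (w^T *m w) 0 0.
have [w0|w0] := eqVneq w 0.
  by rewrite w0 !mul0mx scaler0 subr0 mul1mx; apply/eqP;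
    rewrite -subr_eq0 -/w w0.
have q0 : q != 0 by rewrite sqnorm_cv_eq0.
rewrite mulmxBl mul1mx -scalemxAl -mulmxA [w^T *m u]mx11_scalar mul_mx_scalar.
rewrite scalerA.
(* Equal norms give |u - v|^2 = 2 (|u|^2 - v^T u) = 2 w^T u. *)
suff -> : (w^T *m u) 0 0 = q / 2.
  by rewrite mulrA divfK// divff ?pnatr_eq0// scale1r /w opprB addrC subrK.
apply: (@mulIf _ 2); first by rewrite pnatr_eq0.
rewrite divfK ?pnatr_eq0// /q /w linearB/= !mulmxBl !mulmxBr -uv.
have -> : u^T *m v = v^T *m u.
  apply/matrixP => i j; rewrite !mxE.
  by apply: eq_bigr => k _; rewrite !mxE !ord1 mulrC.
by rewrite !mxE; ring.
Qed.

End householder.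

Section spectral.
Context {R : rcfType}.

(** Over the complex numbers the characteristic polynomial has a root; symmetry forces this root to
    be real, so it is already an eigenvalue of [S] over [R]. *)
Lemma exists_sym_eigenvector n (S : 'M[R]_n.+1) : S^T = S ->
  exists a (v : 'cV[R]_n.+1), v^T *m v = 1%:M /\ S *m v = a *: v.
Proof.
move=> symS.
pose SC := map_mx (real_complex R) S.
have [z zroot] : exists z, root (char_poly SC) z.
  have sz : size (char_poly SC) = n.+2 by rewrite size_char_poly.
  by apply/closed_rootP; rewrite sz.
have /eigenvalueP[w wS w0] : eigenvalue SC z by rewrite eigenvalue_root_char.
have SCh : SC^T = SC by rewrite /SC map_trmx symS.
have SCr : map_mx Num.conj SC = SC.
  apply/matrixP => i j; rewrite !mxE; apply/eqP.
  by rewrite eq_complex/= oppr0 !eqxx.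
pose q := (w *m (map_mx Num.conj w)^T) 0 0.
have q0 : q != 0.
  rewrite /q mxE psumr_eq0; last by move=> i _; rewrite !mxE mul_conjC_ge0.
  apply: contra w0 => /allP w0; apply/eqP/rowP => i; rewrite mxE; apply/eqP.
  by have := w0 i (mem_index_enum i); rewrite !mxE mul_conjC_eq0.
(* Since [SC] is symmetric with real entries, the Hermitian form of [w SC] with [w] equals both [z]
   times [q] and the conjugate of [z] times [q]. *)
have zreal : z^* = z.
  have /matrixP/(_ 0 0) : w *m SC *m (map_mx Num.conj w)^T =
      w *m (map_mx Num.conj (w *m SC))^T.
    by rewrite map_mxM SCr trmx_mul SCh mulmxA.
  rewrite wS map_mxZ/= linearZ/= -scalemxAl -scalemxAr !mxE -/q.
  have -> : \sum_j w 0 j * (map_mx Num.conj w)^T j 0 = q by rewrite /q mxE.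
  by move/(mulIf q0).
have zE : z = (complex.Re z)%:C%C.
  move: zreal => /eqP; case: (z) => a b; rewrite eq_complex/= => /andP[_].
  by rewrite eq_sym -addr_eq0 -mulr2n mulrn_eq0/= => /eqP ->.
have /eigenvalueP[v vS v0] : eigenvalue S (complex.Re z).
  rewrite eigenvalue_root_char -(fmorph_root (real_complex R)) map_char_poly.
  by rewrite [X in root _ X](_ : _ = z).
(* [v] is a row eigenvector; it is transposed and normalised, and symmetry of [S] makes it a column
   eigenvector. *)
exists (complex.Re z), ((Num.sqrt ((v *m v^T) 0 0))^-1 *: v^T).
set r := (v *m v^T) 0 0.
have r0 : 0 < r.
  have := sqnorm_cv_ge0 v^T; rewrite trmxK -/r.
  rewrite le_eqVlt eq_sym => /predU1P[r0|//].
  have := sqnorm_cv_eq0 v^T; rewrite trmxK -/r r0 eqxx => /esym/eqP v0'.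
  by move: v0; rewrite -[v]trmxK v0' trmx0 eqxx.
split.
  rewrite [(_ *: v^T)^T]linearZ/= trmxK -scalemxAl -scalemxAr scalerA.
  rewrite [v *m v^T]mx11_scalar -/r.
  by rewrite scale_scalar_mx -invfM -expr2 sqr_sqrtr ?ltW// mulVf ?gt_eqF.
rewrite -scalemxAr -{1}symS -trmx_mul vS linearZ/= !scalerA.
by congr (_ *: _); rewrite mulrC.
Qed.

(** Deflation: conjugating by a reflection that sends a unit eigenvector to [e0] makes the first
    column a multiple of [e0], hence by symmetry also the first row, and induction diagonalises the
    remaining block. *)
Theorem real_spectral n (S : 'M[R]_n) : S^T = S ->
  exists (U : 'M[R]_n) (d : 'rV[R]_n),
    U^T *m U = 1%:M /\ S = U *m diag_mx d *m U^T.
Proof.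
elim: n S => [|n IH].
  by move=> S _; exists 0, 0; split; apply/matrixP => -[].
rewrite -[n.+1]/(1 + n)%N => S symS.
have [a [v [v1 Sv]]] : exists a (v : 'cV[R]_(1 + n)),
    v^T *m v = 1%:M /\ S *m v = a *: v by exact: exists_sym_eigenvector.
pose e0 : 'cV[R]_(1 + n) := delta_mx 0 0.
have e01 : e0^T *m e0 = 1%:M.
  by rewrite trmx_delta mul_delta_mx; apply/matrixP => i j; rewrite !ord1 !mxE.
pose H := householder v e0.
have Hv : H *m v = e0 by apply: householder_swap; rewrite v1 e01.
have He : H *m e0 = v by rewrite -Hv mulmxA householderK mul1mx.
have HT : H^T = H by exact: householderT.
have HK : H *m H = 1%:M by exact: householderK.
(* Taking [T] from an existential keeps it opaque, with [TD] as its only unfolding. *)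
have [T TD] : exists T : 'M[R]_(1 + n), T = H *m S *m H by eexists.
have symT : T^T = T by rewrite TD !trmx_mul HT symS mulmxA.
have Te : T *m e0 = a *: e0 by rewrite TD -mulmxA He -mulmxA Sv -scalemxAr Hv.
have TE : T = block_mx a%:M 0 0 (drsubmx T).
  have c0 i : T i 0 = a * (i == 0)%:R.
    have /matrixP/(_ i 0) := Te.
    rewrite -colE !mxE => ->; by rewrite andbT.
  have dl : dlsubmx T = 0.
    apply/matrixP => i j; rewrite !mxE !ord1.
    by rewrite [X in T _ X](_ : _ = 0) ?c0 ?mulr0//; exact: val_inj.
  rewrite -{1}(submxK T); congr block_mx => //.
    apply/matrixP => i j; rewrite !mxE !ord1.
    by rewrite [X in T X X](_ : _ = 0) ?c0 ?mulr1 ?mulr1n//; exact: val_inj.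
  by apply: trmx_inj; rewrite trmx_ursub symT dl trmx0.
have symD : (drsubmx T)^T = drsubmx T by rewrite trmx_drsub symT.
have [U [d [U1 DE]]] := IH _ symD.
pose W : 'M[R]_(1 + n) := block_mx 1%:M 0 0 U.
exists (H *m W), (row_mx a%:M d); split.
  rewrite trmx_mul HT -mulmxA (mulmxA H) HK mul1mx /W tr_block_mx !trmx0 trmx1.
  rewrite mulmx_block !mul1mx !mulmx0 !mul0mx !addr0 add0r U1.
  by rewrite -scalar_mx_block.
have SE : S = H *m T *m H by rewrite TD !mulmxA HK mul1mx -mulmxA HK mulmx1.
rewrite SE trmx_mul HT !mulmxA; congr (_ *m _).
rewrite -!mulmxA; congr (_ *m _).
rewrite TE diag_mx_row /W tr_block_mx !trmx0 trmx1 !mulmx_block.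
rewrite !mul1mx !mulmx0 !mul0mx !addr0 !add0r !mulmx1 mulmx0 mulmxA -DE.
congr block_mx.
by apply/matrixP => i j; rewrite !ord1 !mxE.
Qed.

End spectral.

(** * Integration on powers of a measure *)

Lemma measurable_fun_EFin d (T : measurableType d) (R : realType) (f : T -> R) :
  measurable_fun setT f -> measurable_fun setT (fun x => (f x)%:E).
Proof. by move=> mf; apply/measurable_EFinP. Qed.

Section density_integral.
Context d (T : measurableType d) (R : realType).
Variables (mu nu : {measure set T -> \bar R}) (h : T -> R).
Hypotheses (mh : measurable_fun setT h) (h0 : forall x, 0 <= h x).
Hypothesis nuE : forall E, measurable E ->
  nu E = (\int[mu]_(x in E) (h x)%:E)%E.

Import HBNNSimple.
Local Open Scope ereal_scope.

(** The hypothesis [nuE] is the case of indicators; linearity extends it to simple functions and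
    monotone convergence to nonnegative functions. *)
Lemma ge0_integral_density (f : T -> \bar R) :
  measurable_fun setT f -> (forall x, 0 <= f x) ->
  \int[nu]_x f x = \int[mu]_x (f x * (h x)%:E).
Proof.
move=> mf f0; pose f_ := nnsfun_approx measurableT mf.
have cvf x : (f_ n x)%:E @[n --> \oo] --> f x by exact: cvg_nnsfun_approx.
have ndf x : {homo (fun n => (f_ n x)%:E) : m n / (m <= n)%N >-> m <= n}.
  by move=> m n mn; rewrite lee_fin; exact/lefP/nd_nnsfun_approx.
transitivity (limn (fun n => \int[nu]_x (f_ n x)%:E)).
  rewrite -monotone_convergence//.
  - by apply: eq_integral => y _; apply/esym/cvg_lim => //; exact: cvf.
  - by move=> n; exact/measurable_EFinP/measurable_funP.
  - by move=> n y _; rewrite lee_fin.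
transitivity (limn (fun n => \int[mu]_x ((f_ n x)%:E * (h x)%:E))); last first.
  rewrite -monotone_convergence//.
  - apply: eq_integral => y _; apply/cvg_lim => //.
    by apply: cvgeZr => //; exact: cvf.
  - by move=> n; apply: emeasurable_funM; exact/measurable_EFinP.
  - by move=> n y _; rewrite mule_ge0// lee_fin.
  - by move=> x _ m n mn; rewrite lee_wpmul2r ?lee_fin// -lee_fin; exact: ndf.
congr (limn _); apply/funext => n.
under eq_integral do rewrite fimfunE -fsumEFin//.
rewrite ge0_integral_fsum//; last 2 first.
  - by move=> r; exact/measurable_EFinP/measurable_funM.
  - by move=> r x _; rewrite nnfun_muleindic_ge0.
transitivity (\sum_(r \in range (f_ n))
    \int[mu]_x ((r * \1_(f_ n @^-1` [set r]) x)%:E * (h x)%:E)); last first.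
  rewrite -ge0_integral_fsum//; last 2 first.
  - move=> r; apply: emeasurable_funM; last exact/measurable_EFinP.
    exact/measurable_EFinP/measurable_funM.
  - by move=> r x _; rewrite mule_ge0 ?lee_fin// -lee_fin nnfun_muleindic_ge0.
  apply: eq_integral => x _; rewrite [in RHS]fimfunE -fsumEFin//.
  by rewrite ge0_mule_fsuml// => r; rewrite nnfun_muleindic_ge0.
apply: eq_fsbigr => r; rewrite inE => -[x _ <-].
rewrite integralZl_indic_nnsfun// integral_indic// setIT nuE//.
under [RHS]eq_integral do rewrite EFinM -muleA.
rewrite ge0_integralZl//.
- congr (_ * _); rewrite integral_mkcond; apply: eq_integral => y _.
  by rewrite epatch_indic muleC.
- by apply: emeasurable_funM; exact/measurable_EFinP.
- by move=> y _; rewrite mule_ge0// lee_fin.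
- by rewrite lee_fin.
Qed.

End density_integral.

Section power_measure_theory.
Context {R : realType}.
Local Notation RM := (measurableTypeR R).
Variable m : {sigma_finite_measure set RM -> \bar R}.
Local Open Scope ereal_scope.

Lemma measurable_fun_cv_cons n (f : 'cV[R]_n.+1 -> \bar R) :
  measurable_fun setT f ->
  measurable_fun setT (fun xv : RM * 'cV[R]_n => f (cv_cons xv)).
Proof.
by move=> mf; exact: (measurableT_comp mf (@measurable_cv_cons _ n)).
Qed.

Lemma measurable_fun_cv_consr n (f : 'cV[R]_n.+1 -> \bar R) (x : R) :
  measurable_fun setT f -> measurable_fun setT (fun v => f (cv_cons (x, v))).
Proof.
move=> mf; apply: (measurableT_comp (measurable_fun_cv_cons mf)).
exact: (@measurable_fun_pair _ _ _ _ RM).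
Qed.

Lemma integral_power_measure0 (f : 'cV[R]_0 -> \bar R) :
  \int[power_measure m 0]_v f v = f 0%R.
Proof.
rewrite [LHS](_ : _ = \int[\d_(0%R : 'cV[R]_0)]_v f v)//.
rewrite (eq_integral (cst (f 0%R))); last first.
  by move=> x _; rewrite [x]flatmx0; congr f; apply/matrixP => -[].
by rewrite integral_cst//= diracT mule1.
Qed.

Lemma ge0_integral_power_measureS n (f : 'cV[R]_n.+1 -> \bar R) :
  measurable_fun setT f -> (forall v, 0 <= f v) ->
  \int[power_measure m n.+1]_v f v =
  \int[m]_x \int[power_measure m n]_v f (cv_cons (x, v)).
Proof.
move=> mf f0; have mc := @measurable_cv_cons R n.
rewrite [LHS](_ : _ =
  \int[pushforward (m \x power_measure m n)%E (@cv_cons R n)]_v f v)//.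
rewrite ge0_integral_pushforward// preimage_setT.
rewrite (@fubini_tonelli1 _ _ _ _ _ m (power_measure m n))//.
- exact: measurable_fun_cv_cons.
- by move=> x; exact: f0.
Qed.

Lemma measurable_integral_power_measure n (f : 'cV[R]_n.+1 -> \bar R) :
  measurable_fun setT f -> (forall v, 0 <= f v) ->
  measurable_fun setT (fun x => \int[power_measure m n]_v f (cv_cons (x, v))).
Proof.
move=> mf f0.
apply: (@measurable_fun_fubini_tonelli_F _ _ RM _ _ (power_measure m n)
  (fun xv => f (cv_cons xv))) => //.
exact: measurable_fun_cv_cons.
Qed.

End power_measure_theory.

(** * Invariance of Lebesgue measure and Gaussian densities *)

Section matrix_measurability.
Context {R : realType}.

Lemma measurable_mulmx m n p (A : 'M[R]_(m, n)) :
  measurable_fun setT (mulmx A : 'M[R]_(n, p) -> 'M[R]_(m, p)).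
Proof.
apply: measurable_fun_mx => i j; under eq_fun do rewrite mxE.
apply: measurable_sum => k; apply: measurable_funM => //.
exact: measurable_coord.
Qed.

Lemma measurable_fun_addmx d (T : measurableType d) m n
    (f g : T -> 'M[R]_(m, n)) :
  measurable_fun setT f -> measurable_fun setT g ->
  measurable_fun setT (fun x => f x + g x).
Proof.
move=> mf mg; apply: measurable_fun_mx => i j; under eq_fun do rewrite mxE.
by apply: measurable_funD;
  apply: (measurableT_comp (@measurable_coord R m n i j)).
Qed.

Lemma measurable_oppmx m n :
  measurable_fun setT (-%R : 'M[R]_(m, n) -> 'M[R]_(m, n)).
Proof.
apply: measurable_fun_mx => i j; under eq_fun do rewrite mxE.
by apply: measurableT_comp => //; exact: measurable_coord.
Qed.

End matrix_measurability.

Section lebesgue_cv_invariance.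
Context {R : realType}.
Local Notation RM := (measurableTypeR R).
Local Notation mu := (@lebesgue_measure R).
Local Open Scope ereal_scope.

(** Lebesgue measure is determined by its values on half-open intervals, whose lengths a shift
    preserves. *)
Lemma lebesgue_measureD (a : R) (A : set R) : measurable A ->
  pushforward mu (+%R a : _ -> RM) A = mu A.
Proof.
move=> mA; apply/esym.
have ma : measurable_fun [set: RM] (+%R a : _ -> RM).
  exact: measurable_funD.
apply: (lebesgue_measure_unique
  (mu := pushforward mu (+%R a : _ -> RM))) => //.
move=> _ [[b c]] _ <-.
rewrite [RHS](_ : _ = mu `](b - a)%R, (c - a)%R]%classic); last first.
  congr (mu _); apply/seteqP; split=> x /=;
    by rewrite !in_itv/= ltrBlDl lerBrDl.
rewrite !lebesgue_measure_itv/= !lte_fin ltrD2r.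
by case: ifP => // _; rewrite -!EFinB; congr EFin; rewrite opprB addrA subrK.
Qed.

Lemma ge0_integral_lebesgueD (a : R) (f : R -> \bar R) :
  measurable_fun setT f -> (forall x, 0 <= f x) ->
  \int[mu]_x f (a + x)%R = \int[mu]_x f x.
Proof.
move=> mf f0.
have ma : measurable_fun [set: RM] (+%R a : _ -> RM).
  exact: measurable_funD.
rewrite -[RHS](@eq_measure_integral _ _ _ _ _
  (pushforward mu (+%R a : _ -> RM))).
  by rewrite ge0_integral_pushforward.
by move=> A mA _; exact: lebesgue_measureD.
Qed.

Lemma ge0_integral_lebesgueN (f : R -> \bar R) :
  measurable_fun setT f -> (forall x, 0 <= f x) ->
  \int[mu]_x f (- x)%R = \int[mu]_x f x.
Proof.
move=> mf f0.
rewrite -[RHS](@eq_measure_integral _ _ _ _ _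
  (pushforward mu (-%R : _ -> RM))).
  by rewrite ge0_integral_pushforward.
by move=> A mA _; exact: lebesgue_measureN.
Qed.

Lemma cv_consD n (x y : R) (v w : 'cV[R]_n) :
  (cv_cons (x, v) + cv_cons (y, w) = cv_cons (x + y, v + w))%R.
Proof.
by apply/colP => i; rewrite !mxE; case: unliftP => [j|] _ //=; rewrite mxE.
Qed.

Lemma cv_consN n (x : R) (v : 'cV[R]_n) :
  (- cv_cons (x, v) = cv_cons (- x, - v))%R.
Proof.
by apply/colP => i; rewrite !mxE; case: unliftP => [j|] _ //=; rewrite mxE.
Qed.

(** Tonelli splits off the first coordinate, where the one-dimensional invariance applies; induction
    treats the others. *)
Lemma ge0_integral_lebesgue_cvD n (a : 'cV[R]_n) (f : 'cV[R]_n -> \bar R) :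
  measurable_fun setT f -> (forall x, 0 <= f x) ->
  \int[lebesgue_cv n]_x f (a + x)%R = \int[lebesgue_cv n]_x f x.
Proof.
elim: n a f => [|n IH] a f mf f0.
  by rewrite !integral_power_measure0 [(a + 0)%R]flatmx0 -[in RHS](flatmx0 0%R).
rewrite [LHS]ge0_integral_power_measureS; last 2 first.
- by apply: (measurableT_comp mf); exact: measurable_fun_addmx.
- by move=> v; exact: f0.
rewrite [RHS](ge0_integral_power_measureS _ mf f0).
case: (cv_uncons a) (cv_unconsK a) => a0 a' <-.
under eq_integral => x _.
  under eq_integral do rewrite cv_consD.
  rewrite (IH a' (fun v => f (cv_cons ((a0 + x)%R, v))))//; last first.
    exact: measurable_fun_cv_consr.
  over.
rewrite (ge0_integral_lebesgueD a0
  (f := fun x => \int[lebesgue_cv n]_v f (cv_cons (x, v))))//.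
  exact: measurable_integral_power_measure.
by move=> x; exact: integral_ge0.
Qed.

Lemma ge0_integral_lebesgue_cvN n (f : 'cV[R]_n -> \bar R) :
  measurable_fun setT f -> (forall x, 0 <= f x) ->
  \int[lebesgue_cv n]_x f (- x)%R = \int[lebesgue_cv n]_x f x.
Proof.
elim: n f => [|n IH] f mf f0.
  by rewrite !integral_power_measure0 oppr0.
rewrite [LHS]ge0_integral_power_measureS; last 2 first.
- by apply: (measurableT_comp mf); exact: measurable_oppmx.
- by move=> v; exact: f0.
rewrite [RHS](ge0_integral_power_measureS _ mf f0).
under eq_integral => x _.
  under eq_integral do rewrite cv_consN.
  rewrite (IH (fun v => f (cv_cons ((- x)%R, v))))//; last first.
    exact: measurable_fun_cv_consr.
  over.
rewrite (ge0_integral_lebesgueN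
  (f := fun x => \int[lebesgue_cv n]_v f (cv_cons (x, v))))//.
  exact: measurable_integral_power_measure.
by move=> x; exact: integral_ge0.
Qed.

End lebesgue_cv_invariance.

Section gaussian_density.
Context {R : realType}.
Local Notation RM := (measurableTypeR R).

(** The [s i] are standard deviations: for positive [s] this is the density of N(0, diag(s^2)). *)
Definition normal_pdf_cv n (s : 'I_n -> R) (x : 'cV[R]_n) : R :=
  \prod_i normal_pdf 0 (s i) (x i 0).

Lemma normal_pdf_cv_cons n (s : 'I_n.+1 -> R) x v :
  normal_pdf_cv s (cv_cons (x, v)) =
  normal_pdf 0 (s ord0) x * normal_pdf_cv (fun i => s (lift ord0 i)) v.
Proof.
rewrite /normal_pdf_cv big_ord_recl mxE unlift_none; congr (_ * _).
by apply: eq_bigr => i _; rewrite mxE liftK.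
Qed.

Lemma normal_pdf_cv_ge0 n (s : 'I_n -> R) x : 0 <= normal_pdf_cv s x.
Proof. by apply: prodr_ge0 => i _; exact: normal_pdf_ge0. Qed.

Lemma normal_pdf_gt0 (m s x : R) : s != 0 -> 0 < normal_pdf m s x.
Proof.
by move=> s0; rewrite normal_pdfE// mulr_gt0 ?normal_peak_gt0 ?expR_gt0.
Qed.

Lemma normal_pdf_cv_gt0 n (s : 'I_n -> R) x :
  (forall i, s i != 0) -> 0 < normal_pdf_cv s x.
Proof. by move=> s0; apply: prodr_gt0 => i _; exact: normal_pdf_gt0. Qed.

Lemma measurable_normal_pdf_cv n (s : 'I_n -> R) :
  measurable_fun setT (normal_pdf_cv s).
Proof.
apply: measurable_prod => i _.
apply: (measurableT_comp (measurable_normal_pdf 0 (s i))).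
exact: measurable_coord.
Qed.

Lemma emeasurable_normal_pdf_cv n (s : 'I_n -> R) :
  measurable_fun setT (fun x => (normal_pdf_cv s x)%:E).
Proof. apply: measurable_fun_EFin; exact: measurable_normal_pdf_cv. Qed.

Lemma normal_pdf_scale (s x : R) : 0 < s ->
  normal_pdf 0 s (s * x) = s^-1 * normal_pdf 0 1 x.
Proof.
move=> s0; rewrite !normal_pdfE ?oner_eq0 ?gt_eqF//.
rewrite /normal_peak /normal_fun mulrA; congr (_ * expR _).
  rewrite expr1n mul1r -mulrnAr sqrtrM ?sqr_ge0// sqrtr_sqr gtr0_norm//.
  by rewrite invfM.
rewrite !subr0 exprMn expr1n -(mulr_natr (s ^+ 2)) !mulNr; congr (- _).
by rewrite invfM mulrACA divff ?mul1r// expf_neq0// gt_eqF.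
Qed.

(** The standard density depends on [x] only through its norm, which is the source of rotation
    invariance. *)
Lemma normal_pdf_cv1E n (x : 'cV[R]_n) :
  normal_pdf_cv (fun=> 1) x =
  normal_peak 1 ^+ n * expR (- ((x^T *m x) 0 0 / 2)).
Proof.
rewrite /normal_pdf_cv; under eq_bigr do rewrite normal_pdfE ?oner_eq0//.
rewrite big_split/= prodr_const card_ord -expR_sum; congr (_ * expR _).
rewrite mxE mulr_suml -sumrN; apply: eq_bigr => i _.
by rewrite mxE subr0 expr1n expr2 mulNr.
Qed.

Lemma normal_pdf_cv_diag n (s : 'I_n -> R) (x : 'cV[R]_n) :
  (forall i, 0 < s i) ->
  normal_pdf_cv s (diag_mx (\row_i s i) *m x) =
  (\prod_i s i)^-1 * normal_pdf_cv (fun=> 1) x.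
Proof.
move=> s0; rewrite /normal_pdf_cv -prodfV -big_split/=; apply: eq_bigr => i _.
by rewrite mul_diag_mx !mxE normal_pdf_scale.
Qed.

Local Open Scope ereal_scope.

Lemma integral_normal_pdf_cv n (s : 'I_n -> R) :
  \int[lebesgue_cv n]_x (normal_pdf_cv s x)%:E = 1.
Proof.
elim: n s => [|n IH] s.
  by rewrite integral_power_measure0 /normal_pdf_cv big_ord0.
have ge0 m (t : 'I_m -> R) x : 0 <= (normal_pdf_cv t x)%:E.
  by rewrite lee_fin normal_pdf_cv_ge0.
rewrite ge0_integral_power_measureS//; last exact: emeasurable_normal_pdf_cv.
under eq_integral => x _.
  under eq_integral do rewrite normal_pdf_cv_cons EFinM.
  rewrite ge0_integralZl ?lee_fin ?normal_pdf_ge0//; last first.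
    exact: emeasurable_normal_pdf_cv.
  rewrite IH mule1.
  over.
exact: integral_normal_pdf.
Qed.

Lemma ge0_integral_normal_prob (f : R -> \bar R) (a s : R) :
  measurable_fun setT f -> (forall x, 0 <= f x) ->
  \int[normal_prob a s]_x f x =
  \int[lebesgue_measure]_x (f x * (normal_pdf a s x)%:E).
Proof.
move=> mf f0.
apply: (@ge0_integral_density _ RM _ lebesgue_measure (normal_prob a s)) => //.
- exact: measurable_normal_pdf.
- exact: normal_pdf_ge0.
Qed.

Lemma ge0_integral_std_gaussian n (f : 'cV[R]_n -> \bar R) :
  measurable_fun setT f -> (forall x, 0 <= f x) ->
  \int[std_gaussian n]_x f x =
  \int[lebesgue_cv n]_x (f x * (normal_pdf_cv (fun=> 1) x)%:E).
Proof.
elim: n f => [|n IH] f mf f0.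
  by rewrite !integral_power_measure0 /normal_pdf_cv big_ord0 mule1.
rewrite !ge0_integral_power_measureS//; last 2 first.
- by apply: emeasurable_funM => //; exact: emeasurable_normal_pdf_cv.
- by move=> v; rewrite mule_ge0// lee_fin normal_pdf_cv_ge0.
rewrite ge0_integral_normal_prob//; last 2 first.
- exact: measurable_integral_power_measure.
- by move=> x; exact: integral_ge0.
apply: eq_integral => x _.
rewrite [in LHS](IH (fun v => f (cv_cons (x, v))))//; last first.
  exact: measurable_fun_cv_consr.
under [RHS]eq_integral do rewrite normal_pdf_cv_cons EFinM muleCA.
rewrite ge0_integralZl//; first by rewrite muleC.
- apply: emeasurable_funM; last exact: emeasurable_normal_pdf_cv.
  exact: measurable_fun_cv_consr.
- by move=> v _; rewrite mule_ge0// lee_fin normal_pdf_cv_ge0.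
- by rewrite lee_fin normal_pdf_ge0.
Qed.

(* The Fubini argument for uniqueness of Haar measure: both sides are the
   integral of f (M x) h (M x + y) over all x and y. *)
Lemma ge0_integral_lebesgue_cv_mulmx n (M : 'M[R]_n)
    (f h : 'cV[R]_n -> \bar R) :
  M \in unitmx ->
  measurable_fun setT f -> (forall x, 0 <= f x) ->
  measurable_fun setT h -> (forall x, 0 <= h x) ->
  \int[lebesgue_cv n]_x h x = 1 ->
  \int[lebesgue_cv n]_x f (M *m x) =
  (\int[lebesgue_cv n]_x h (M *m x)) * \int[lebesgue_cv n]_x f x.
Proof.
move=> Mu mf f0 mh h0 h1.
have mM := @measurable_mulmx R n n 1 M.
have mfM : measurable_fun setT (fun x => f (M *m x)).
  exact: measurableT_comp mf mM.
have mhM : measurable_fun setT (fun x => h (M *m x)).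
  exact: measurableT_comp mh mM.
have m1 : measurable_fun setT (fun xy : 'cV[R]_n * 'cV[R]_n => M *m xy.1).
  by apply: (measurableT_comp mM); exact: measurable_fst.
have m2 : measurable_fun setT (fun xy : 'cV[R]_n * 'cV[R]_n => xy.2).
  exact: measurable_snd.
transitivity (\int[lebesgue_cv n]_x \int[lebesgue_cv n]_y
    (f (M *m x) * h (M *m x + y)%R)).
  apply: eq_integral => x _; rewrite ge0_integralZl//; last first.
    by apply: (measurableT_comp mh); exact: measurable_fun_addmx.
  by rewrite ge0_integral_lebesgue_cvD// h1 mule1.
rewrite (@fubini_tonelli _ _ _ _ _ (lebesgue_cv n) (lebesgue_cv n)
  (fun xy => f (M *m xy.1) * h (M *m xy.1 + xy.2)%R)); last 2 first.
- apply: emeasurable_funM.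
    by apply: (measurableT_comp mf).
  by apply: (measurableT_comp mh); exact: measurable_fun_addmx.
- by move=> xy; rewrite mule_ge0.
(* For fixed [y], translating [x] by the preimage of [y] under [M] moves the shift from [h] to
   [f]. *)
transitivity (\int[lebesgue_cv n]_y \int[lebesgue_cv n]_x
    (h (M *m x) * f (M *m x + - y)%R)).
  apply: eq_integral => y _ /=.
  rewrite -(ge0_integral_lebesgue_cvD (- (invmx M *m y))%R); last 2 first.
  - apply: emeasurable_funM => //.
    by apply: (measurableT_comp mh); exact: measurable_fun_addmx.
  - by move=> x; rewrite mule_ge0.
  apply: eq_integral => x _.
  by rewrite mulmxDr mulmxN mulKVmx// [(- y + _)%R]addrC subrK muleC.
transitivity (\int[lebesgue_cv n]_x \int[lebesgue_cv n]_y
    (h (M *m x) * f (M *m x + - y)%R)).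
  apply/esym.
  apply: (@fubini_tonelli _ _ _ _ _ (lebesgue_cv n) (lebesgue_cv n)
    (fun xy => h (M *m xy.1) * f (M *m xy.1 + - xy.2)%R)).
    apply: emeasurable_funM.
      by apply: (measurableT_comp mh).
    apply: (measurableT_comp mf); apply: measurable_fun_addmx => //.
    exact: (measurableT_comp (@measurable_oppmx R n 1)).
  by move=> xy; rewrite mule_ge0.
(* For fixed [x], reflection and translation in [y] turn the inner integral of [f] into its plain
   integral. *)
rewrite -ge0_integralZr//; last exact: integral_ge0.
apply: eq_integral => x _ /=.
have mfD : measurable_fun setT (fun y => f (M *m x + y)%R).
  by apply: (measurableT_comp mf); exact: measurable_fun_addmx.
rewrite ge0_integralZl//.
- by rewrite (ge0_integral_lebesgue_cvN mfD)// ge0_integral_lebesgue_cvD.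
- exact: (measurableT_comp mfD (@measurable_oppmx R n 1)).
Qed.

(** The scaling constant of [O] is found by testing on the standard Gaussian density, which [O]
    leaves unchanged; it is therefore 1. *)
Lemma ge0_integral_lebesgue_cv_orthogonal n (O : 'M[R]_n)
    (f : 'cV[R]_n -> \bar R) :
  O^T *m O = 1%:M ->
  measurable_fun setT f -> (forall x, 0 <= f x) ->
  \int[lebesgue_cv n]_x f (O *m x) = \int[lebesgue_cv n]_x f x.
Proof.
move=> OO mf f0.
rewrite (@ge0_integral_lebesgue_cv_mulmx _ O f
  (fun x => (normal_pdf_cv (fun=> 1%R) x)%:E))//; first last.
- exact: integral_normal_pdf_cv.
- by move=> x; rewrite lee_fin normal_pdf_cv_ge0.
- exact: emeasurable_normal_pdf_cv.
- by have [_] := mulmx1_unit OO.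
under eq_integral do
  rewrite normal_pdf_cv1E trmx_mul mulmxA -(mulmxA _ O^T) OO mulmx1
    -normal_pdf_cv1E.
by rewrite integral_normal_pdf_cv mul1e.
Qed.

Lemma ge0_integral_std_gaussian_diag n (s : 'I_n -> R)
    (f : 'cV[R]_n -> \bar R) :
  (forall i, (0 < s i)%R) ->
  measurable_fun setT f -> (forall x, 0 <= f x) ->
  \int[std_gaussian n]_x f (diag_mx (\row_i s i) *m x) =
  \int[lebesgue_cv n]_x (f x * (normal_pdf_cv s x)%:E).
Proof.
move=> s0 mf f0; set M := diag_mx _.
have Ps : (0 < \prod_i s i)%R by exact: prodr_gt0.
have Mu : M \in unitmx.
  rewrite unitmxE det_diag unitfE; under eq_bigr do rewrite mxE.
  by rewrite gt_eqF.
have mM := @measurable_mulmx R n n 1 M.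
have g0 (t : 'I_n -> R) x : 0 <= (normal_pdf_cv t x)%:E.
  by rewrite lee_fin normal_pdf_cv_ge0.
have mg (t : 'I_n -> R) : measurable_fun setT (fun x => (normal_pdf_cv t x)%:E).
  exact: emeasurable_normal_pdf_cv.
have mfg : measurable_fun setT (fun x => f x * (normal_pdf_cv s x)%:E).
  exact: emeasurable_funM.
rewrite [LHS]ge0_integral_std_gaussian; last 2 first.
- exact: measurableT_comp mf mM.
- by move=> x; exact: f0.
(* By [normal_pdf_cv_diag] the standard density at [x] is the product of the [s i] times the density
   with deviations [s] at [M x], so the integrand becomes a function of [M x]. *)
transitivity (\int[lebesgue_cv n]_x ((\prod_i s i)%:E *
    (f (M *m x) * (normal_pdf_cv s (M *m x))%:E))).
  apply: eq_integral => x _; rewrite normal_pdf_cv_diag// EFinM muleCA.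
  rewrite (muleA (\prod_i s i)%:E).
  by rewrite -!EFinM divff ?gt_eqF// mul1r.
rewrite ge0_integralZl//; last 3 first.
- exact: (measurableT_comp mfg mM).
- by move=> x _; rewrite mule_ge0.
- by rewrite lee_fin ltW.
(* Testing on [normal_pdf_cv s] gives the scaling constant of [M] as the inverse of the product of
   the [s i], which cancels the factor in front. *)
rewrite (@ge0_integral_lebesgue_cv_mulmx _ M
  (fun x => f x * (normal_pdf_cv s x)%:E)
  (fun x => (normal_pdf_cv s x)%:E))//; first last.
- exact: integral_normal_pdf_cv.
- by move=> x; rewrite mule_ge0.
under eq_integral do rewrite normal_pdf_cv_diag// EFinM.
rewrite ge0_integralZl//; last by rewrite lee_fin invr_ge0 ltW.
by rewrite integral_normal_pdf_cv mule1 muleA -EFinM divff ?gt_eqF// mul1e.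
Qed.

End gaussian_density.

(** * Second moment of the standard normal law *)

Section second_moment.
Context {R : realType}.
Local Notation mu := (@lebesgue_measure R).
Local Notation RM := (measurableTypeR R).
Local Notation phi := (normal_pdf 0 1 : R -> R).

Lemma normal_pdf01E (t : R) : phi t = normal_peak 1 * expR (- (t ^+ 2 / 2)).
Proof. by rewrite normal_pdfE ?oner_eq0// /normal_fun subr0 expr1n mulNr. Qed.

Lemma is_derive_normal_pdf01 (t : R) :
  is_derive t 1 (fun x => - phi x) (t * phi t).
Proof.
rewrite [X in is_derive _ _ X _](_ : _ =
    (fun x => - normal_peak 1 * expR (- (x ^+ 2 / 2)))); last first.
  by apply/funext => x; rewrite normal_pdf01E mulNr.
apply: is_derive_eq.
by rewrite normal_pdf01E /GRing.scale/=; field.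
Qed.

Lemma cvg_normal_pdf01 : phi x @[x --> +oo%R] --> (0 : R).
Proof.
rewrite [X in X @ _ --> _](_ : _ =
    (fun x => normal_peak 1 * expR (- (x ^+ 2 / 2)))); last first.
  by apply/funext => x; rewrite normal_pdf01E.
rewrite -[X in _ --> X](mulr0 (normal_peak 1)).
apply: cvgM; first exact: cvg_cst.
apply: (cvg_comp (fun x : R => x ^+ 2 / 2) (fun x => expR (- x))).
  by apply: gt0_cvgMly; [rewrite invr_gt0|exact: cvgr_expr2].
exact: cvgr_expR.
Qed.

Local Open Scope ereal_scope.

(** [- phi] is an antiderivative of [t * phi t] and vanishes at infinity. *)
Lemma integral_normal_pdf01_tail (x : R) : (0 <= x)%R ->
  \int[mu]_(t in `[x, +oo[) (t * phi t)%:E = (phi x)%:E.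
Proof.
move=> x0.
rewrite (@ge0_continuous_FTC2y _
  (fun t => t * phi t)%R (fun t => - phi t)%R x 0%R).
- by rewrite -EFinB sub0r opprK.
- by move=> t xt; rewrite mulr_ge0 ?normal_pdf_ge0// (le_trans x0).
- apply: continuous_subspaceT => t; apply: cvgM; first exact: cvg_id.
  by apply: continuous_normal_pdf; rewrite oner_eq0.
- by rewrite -[X in _ --> X]oppr0; apply: cvgN; exact: cvg_normal_pdf01.
- by move=> t _; have := is_derive_normal_pdf01 t; case.
- apply: cvg_at_right_filter; apply: cvgN.
  by apply: continuous_normal_pdf; rewrite oner_eq0.
- by move=> t _; rewrite derive1E; have := is_derive_normal_pdf01 t; case.
Qed.

Let half_line : [set x : R | (0 <= x)%R] = `[0%R, +oo[%classic.
Proof. by apply/seteqP; split => x /=; rewrite in_itv/= andbT. Qed.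

(* Tonelli applied to t phi(t) on the region 0 <= x <= t, since phi(x) is the
   integral of t phi(t) over [x, +oo[. *)
Lemma integral_half_sqr_normal_pdf01 :
  \int[mu]_(t in `[0%R, +oo[) (t ^+ 2 * phi t)%:E =
  \int[mu]_(t in `[0%R, +oo[) (phi t)%:E.
Proof.
have mphi : measurable_fun setT phi := measurable_normal_pdf 0 1.
pose G (xt : RM * RM) : \bar R :=
  if (0 <= xt.1)%R && (xt.1 <= xt.2)%R then (xt.2 * phi xt.2)%:E else 0.
have mG : measurable_fun setT G.
  apply: measurable_fun_ifT => //.
    by apply: measurable_and; apply: measurable_fun_ler.
  apply: measurable_fun_EFin; apply: measurable_funM => //.
  exact: (measurableT_comp mphi).
have G0 xt : 0 <= G xt.
  rewrite /G; case: ifPn => // /andP[x0 xt1].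
  by rewrite lee_fin mulr_ge0 ?normal_pdf_ge0// (le_trans x0).
rewrite [LHS]integral_mkcond [RHS]integral_mkcond.
transitivity (\int[mu]_t \int[mu]_x G (x, t)).
  apply: eq_integral => t _; rewrite patchE mem_setE in_itv/= andbT.
  have [t0|t0] := leP 0%R t.
    (* For fixed [t] the slice of the region has length [t], which supplies the second factor
       [t]. *)
    transitivity (\int[mu]_(x in `[0%R, t]) (t * phi t)%:E).
      by rewrite integral_cst//= lebesgue_measure_itv/= lte_fin;
        case: ltgtP t0 => // [t0 _|<- _];
        rewrite -?EFinB ?subr0 -?EFinM ?mul0r ?mul0e ?expr0n ?mul0r//
          expr2 mulrAC.
    rewrite integral_mkcond; apply: eq_integral => x _.
    by rewrite patchE mem_setE in_itv/= /G.
  rewrite (eq_integral (cst 0)) ?integral0// => x _; rewrite /G/=.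
  by case: ifPn => // /andP[x0 /(le_trans x0)]; rewrite leNgt t0.
rewrite -(@fubini_tonelli _ _ RM RM _ mu mu G)//.
apply: eq_integral => x _; rewrite patchE mem_setE in_itv/= andbT.
have [x0|x0] := leP 0%R x.
  rewrite -integral_normal_pdf01_tail// [RHS]integral_mkcond.
  apply: eq_integral => t _.
  by rewrite patchE mem_setE in_itv/= andbT /G/= x0.
rewrite (eq_integral (cst 0)) ?integral0// => t _; rewrite /G/=.
by rewrite leNgt x0.
Qed.

Lemma integral_sqr_normal_prob01 :
  \int[normal_prob 0 1]_x (x ^+ 2)%:E = 1 :> \bar R.
Proof.
have cphi : continuous phi by apply: continuous_normal_pdf; rewrite oner_eq0.
have phiN (x : R) : phi (- x)%R = phi x by rewrite !normal_pdf01E sqrrN.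
rewrite ge0_integral_normal_prob//; last 2 first.
- by apply: measurable_fun_EFin; exact: measurable_funX.
- by move=> x; rewrite lee_fin sqr_ge0.
under eq_integral do rewrite -EFinM.
(* Both integrands are even, so the comparison on the half line suffices. *)
rewrite ge0_symfun_integralT; last 3 first.
- by move=> x; rewrite mulr_ge0 ?normal_pdf_ge0 ?sqr_ge0.
- by move=> x; apply: cvgM; [exact: sqr_continuous|exact: cphi].
- by move=> x /=; rewrite phiN sqrrN.
rewrite half_line integral_half_sqr_normal_pdf01 -half_line.
rewrite -ge0_symfun_integralT//.
- exact: integral_normal_pdf.
- by move=> x; exact: normal_pdf_ge0.
- by move=> x; rewrite /= phiN.
Qed.

End second_moment.

(** * Images of standard normal vectors under coisometries *)

Section coisometry.
Context {R : realType}.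
Local Open Scope ereal_scope.

Lemma ge0_integral_std_gaussian_orthogonal n (O : 'M[R]_n)
    (f : 'cV[R]_n -> \bar R) :
  O^T *m O = 1%:M ->
  measurable_fun setT f -> (forall x, 0 <= f x) ->
  \int[std_gaussian n]_x f (O *m x) = \int[std_gaussian n]_x f x.
Proof.
move=> OO mf f0; have mO := @measurable_mulmx R n n 1 O.
rewrite !ge0_integral_std_gaussian//; last exact: (measurableT_comp mf mO).
rewrite -[RHS](@ge0_integral_lebesgue_cv_orthogonal _ _ _
  (fun x => f x * (normal_pdf_cv (fun=> 1%R) x)%:E) OO); last 2 first.
- by apply: emeasurable_funM => //; exact: emeasurable_normal_pdf_cv.
- by move=> x; rewrite mule_ge0// lee_fin normal_pdf_cv_ge0.
apply: eq_integral => x _; congr (_ * _%:E).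
by rewrite !normal_pdf_cv1E trmx_mul mulmxA -(mulmxA _ O^T) OO mulmx1.
Qed.

Lemma std_gaussian_setT n : std_gaussian n setT = 1 :> \bar R.
Proof.
rewrite -[LHS]mul1e -integral_cst// ge0_integral_std_gaussian//.
rewrite -[RHS](@integral_normal_pdf_cv R n (fun=> 1%R)).
by apply: eq_integral => x _; rewrite mul1e.
Qed.

Lemma mulmx_cv_cons m n (N : 'M[R]_(m, n.+1)) x v i :
  ((N *m cv_cons (x, v)) i 0 =
    N i ord0 * x + \sum_j N i (lift ord0 j) * v j 0)%R.
Proof.
rewrite mxE big_ord_recl mxE unlift_none; congr (_ + _)%R.
by apply: eq_bigr => j _; rewrite mxE liftK.
Qed.

(* A reflection moves the first row of W to the first basis vector, which splits
   off one coordinate. *)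
Lemma ge0_integral_std_gaussian_coisometry K l (W : 'M[R]_(K, l))
    (f : 'cV[R]_K -> \bar R) :
  W *m W^T = 1%:M ->
  measurable_fun setT f -> (forall x, 0 <= f x) ->
  \int[std_gaussian l]_z f (W *m z) = \int[std_gaussian K]_z f z.
Proof.
elim: K l W f => [|K IH] l W f WW mf f0.
  rewrite integral_power_measure0 (eq_integral (cst (f 0%R))); last first.
    by move=> z _; rewrite [(W *m z)%R]flatmx0.
  by rewrite integral_cst//= std_gaussian_setT mule1.
(* A matrix without columns cannot have a unit row, so [l] is positive. *)
case: l W WW => [|l] W WW.
  move/matrixP/(_ ord0 ord0): WW.
  by rewrite !mxE big_ord0 eqxx => /esym/eqP; rewrite oner_eq0.
pose w : 'cV[R]_l.+1 := (row ord0 W)^T.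
pose e0 : 'cV[R]_l.+1 := delta_mx ord0 ord0.
have we : w^T *m w = e0^T *m e0.
  apply/matrixP => i j; rewrite !ord1 trmx_delta mul_delta_mx.
  have /matrixP/(_ ord0 ord0) := WW; rewrite !mxE /= => <-.
  by apply: eq_bigr => k _; rewrite !mxE.
have [H [HT HK Hw]] : exists H : 'M[R]_l.+1,
    [/\ H^T = H, H *m H = 1%:M & H *m w = e0].
  by exists (householder w e0); split;
    [exact: householderT|exact: householderK|exact: householder_swap].
have HH : H^T *m H = 1%:M by rewrite HT.
have [N ND] : exists N, N = W *m H by eexists.
have NN : N *m N^T = 1%:M.
  by rewrite ND trmx_mul mulmxA -(mulmxA W) HT HK mulmx1.
have N0 j : N ord0 j = (j == ord0)%:R.
  have /matrixP/(_ j ord0) := Hw; rewrite ND !mxE andbT => <-.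
  by apply: eq_bigr => k _; rewrite !mxE mulrC -[H in LHS]HT mxE.
(* The other rows of [N] are orthogonal to its first row, which is the first basis vector. *)
have Nl i : N (lift ord0 i) ord0 = 0%R.
  have /matrixP/(_ (lift ord0 i) ord0) := NN.
  rewrite !mxE big_ord_recl /= !mxE N0 eqxx mulr1 big1 ?addr0// => k _.
  by rewrite !mxE N0 mulr0.
pose W' : 'M[R]_(K, l) := \matrix_(i, j) N (lift ord0 i) (lift ord0 j).
have W'W' : W' *m W'^T = 1%:M.
  apply/matrixP => i j.
  have /matrixP/(_ (lift ord0 i) (lift ord0 j)) := NN.
  rewrite !mxE big_ord_recl /= Nl mul0r add0r (inj_eq lift_inj) => <-.
  by apply: eq_bigr => k _; rewrite !mxE.
have NE x v : N *m cv_cons (x, v) = cv_cons (x, W' *m v).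
  apply/colP => i; rewrite mulmx_cv_cons mxE; case: unliftP => [j|] -> /=.
    by rewrite Nl mul0r add0r mxE; apply: eq_bigr => k _; rewrite mxE.
  by rewrite N0 eqxx mul1r big1 ?addr0// => k _; rewrite N0 mul0r.
rewrite -(ge0_integral_std_gaussian_orthogonal HH); last 2 first.
- exact: (measurableT_comp mf (@measurable_mulmx R _ _ 1 W)).
- by [].
under eq_integral do rewrite mulmxA -ND.
rewrite !ge0_integral_power_measureS//; last first.
  exact: (measurableT_comp mf (@measurable_mulmx R _ _ 1 N)).
apply: eq_integral => x _; under eq_integral do rewrite NE.
apply: (IH l W' (fun v => f (cv_cons (x, v)))) => //.
exact: measurable_fun_cv_consr.
Qed.

(** A normalised nonzero row is a coisometry onto dimension one, so its product with [z] is standard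
    normal and has second moment 1. *)
Lemma integral_std_gaussian_sqr_dot n (w : 'rV[R]_n) :
  \int[std_gaussian n]_z (((w *m z) 0 0) ^+ 2)%:E = ((w *m w^T) 0 0)%:E.
Proof.
have [->|w0] := eqVneq w 0%R.
  rewrite mul0mx mxE (eq_integral (cst 0)) ?integral0// => z _.
  by rewrite mul0mx mxE expr0n.
set r := ((w *m w^T) 0 0)%R.
have r0 : (0 < r)%R.
  rewrite lt0r /r -{1 3}[w]trmxK sqnorm_cv_eq0 sqnorm_cv_ge0 andbT.
  by apply: contra w0 => /eqP w0; rewrite -[w]trmxK w0 trmx0.
pose W := ((Num.sqrt r)^-1 *: w)%R.
have WW : W *m W^T = 1%:M.
  rewrite linearZ/= -scalemxAl -scalemxAr scalerA [w *m w^T]mx11_scalar -/r.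
  by rewrite scale_scalar_mx -invfM -expr2 sqr_sqrtr ?ltW// mulVf ?gt_eqF.
have ms : measurable_fun setT (fun z : 'cV[R]_1 => ((z 0 0) ^+ 2)%:E : \bar R).
  apply: measurable_fun_EFin; apply: measurable_funX.
  exact: measurable_coord.
have s0 (z : 'cV[R]_1) : 0 <= ((z 0 0)%R ^+ 2)%:E by rewrite lee_fin sqr_ge0.
transitivity (\int[std_gaussian n]_z (r%:E * ((((W *m z) 0 0)%R ^+ 2)%:E))).
  apply: eq_integral => z _; rewrite -EFinM -scalemxAl [in RHS]mxE exprMn mulrA.
  by rewrite exprVn sqr_sqrtr ?ltW// divff ?mul1r ?gt_eqF.
rewrite ge0_integralZl//; last 2 first.
- exact: (measurableT_comp ms (@measurable_mulmx R _ _ 1 W)).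
- by rewrite lee_fin ltW.
rewrite (ge0_integral_std_gaussian_coisometry WW ms s0).
rewrite ge0_integral_power_measureS//.
under eq_integral do rewrite integral_power_measure0 mxE unlift_none/=.
by rewrite integral_sqr_normal_prob01 mule1.
Qed.

Lemma integral_std_gaussian_sqnorm m n (N : 'M[R]_(m, n)) :
  \int[std_gaussian n]_z (((N *m z)^T *m (N *m z)) 0 0)%:E =
  (\tr (N *m N^T))%:E.
Proof.
transitivity (\int[std_gaussian n]_z \sum_i (((row i N *m z) 0 0)%R ^+ 2)%:E).
  apply: eq_integral => z _; rewrite sqnorm_cvE -sumEFin.
  by apply: eq_bigr => i _; rewrite -row_mul [in RHS]mxE.
rewrite ge0_integral_sum//; last 2 first.
- move=> i; apply: measurable_fun_EFin; apply: measurable_funX.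
  have mN := measurableT_comp (@measurable_coord R 1 1 0%R 0%R)
    (@measurable_mulmx R _ _ 1 (row i N)).
  exact: mN.
- by move=> i z _; rewrite lee_fin sqr_ge0.
rewrite /mxtrace -sumEFin; apply: eq_bigr => i _.
rewrite integral_std_gaussian_sqr_dot; congr EFin; rewrite !mxE.
by apply: eq_bigr => k _; rewrite !mxE.
Qed.

End coisometry.

(** * Densities and quasi-KL divergence of Gaussian laws *)

Section density_uniqueness.
Context {R : realType}.
Section ae.
Local Open Scope ereal_scope.

Lemma ge0_integral_lty_integrable d (T : measurableType d)
    (mu : {measure set T -> \bar R}) (f : T -> R) :
  measurable_fun setT f -> (forall x, (0 <= f x)%R) ->
  \int[mu]_x (f x)%:E < +oo -> mu.-integrable setT (EFin \o f).
Proof.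
move=> mf f0 fy; apply/integrableP; split; first exact/measurable_EFinP.
by under eq_integral do rewrite /= ger0_norm//.
Qed.

(** Since [mu] has finite mass, the densities are integrable, and integrable functions with equal
    integrals over all measurable sets agree almost everywhere. *)
Lemma is_density_ae_eq D (lam : {measure set 'cV[R]_D -> \bar R})
    (mu : probability 'cV[R]_D R) (f g : 'cV[R]_D -> R) :
  is_density lam mu f -> is_density lam mu g -> {ae lam, forall x, f x = g x}.
Proof.
move=> [mf f0 muf] [mg g0 mug].
have fi : lam.-integrable setT (fun x => (f x)%:E).
  apply: ge0_integral_lty_integrable => //.
  by rewrite -muf// probability_setT ltry.
have mEg : measurable_fun setT (fun x => (g x)%:E).
  exact: measurable_fun_EFin.
have := @integral_ae_eq _ _ R lam setT measurableT
  (fun x => (g x)%:E) (fun x => (f x)%:E) fi mEg.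
have fg E : E `<=` setT -> measurable E ->
    \int[lam]_(x in E) (f x)%:E = \int[lam]_(x in E) (g x)%:E.
  by move=> _ mE; rewrite -muf// -mug.
by move=> /(_ fg); apply: filterS => x /(_ I) [].
Qed.

End ae.

Lemma measurable_cv_box n (x : 'cV[R]_n) (e : R) :
  measurable [set y : 'cV[R]_n | forall i, ball (x i 0) e (y i 0)].
Proof.
rewrite [X in measurable X](_ : _ =
    \bigcap_(i in [set: 'I_n])
      ((fun M : 'cV[R]_n => M i 0) @^-1` ball (x i 0) e)).
  apply: fin_bigcap_measurable => // i _; rewrite -[X in measurable X]setTI.
  exact: measurable_coord (measurable_ball _ _).
by apply/seteqP; split => y /= h i; [move=> _; exact: h|exact: h].
Qed.

(** Boxes are the balls of the matrix norm, written by coordinates so that they split as products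
    along the recursion of [power_measure]. *)
Lemma lebesgue_cv_box_gt0 n (x : 'cV[R]_n) (e : R) : 0 < e ->
  (0 < lebesgue_cv n [set y | forall i, ball (x i 0%R) e (y i 0%R)])%E.
Proof.
move=> e0; elim: n x => [|n IH] x.
  rewrite [X in (0 < X)%E](_ : _ =
    \d_(0%R : 'cV[R]_0)
      [set y : 'cV[R]_0 | forall i, ball (x i 0) e (y i 0)])//.
  by rewrite diracE mem_set ?lte_fin// => -[].
set box := [set y | _].
rewrite [X in (0 < X)%E](_ : _ = (lebesgue_measure \x lebesgue_cv n)%E
    (@cv_cons R n @^-1` box))//.
rewrite (_ : _ @^-1` _ = ball (x ord0 0) e `*`
    [set y : 'cV[R]_n | forall i, ball (x (lift ord0 i) 0) e (y i 0)]);
  last first.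
  apply/seteqP; split => -[a v] /=.
    move=> h; split; first by have := h ord0; rewrite mxE unlift_none.
    by move=> i; have := h (lift ord0 i); rewrite mxE liftK.
  by move=> [ha hv] i; rewrite mxE; case: unliftP => [j|] -> /=; [exact: hv|].
rewrite product_measure1E//; last 2 first.
- exact: measurable_ball.
- have := measurable_cv_box (\col_i x (lift ord0 i) 0)%R e.
  by under eq_set do under eq_forall do rewrite mxE.
rewrite mule_gt0//.
  rewrite [X in (0 < X)%E](_ : _ = lebesgue_measure (ball (x ord0 0) e))//.
  by rewrite lebesgue_measure_ball ?ltW// lte_fin mulrn_wgt0.
have := IH (\col_i x (lift ord0 i) 0)%R.
by under eq_set do under eq_forall do rewrite mxE.
Qed.

(** If [f] and [g] differ at a point, they differ on a whole box around it, and no box is contained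
    in a null set. *)
Lemma continuous_ae_eq n (f g : 'cV[R]_n -> R) :
  continuous f -> continuous g ->
  {ae lebesgue_cv n, forall x, f x = g x} -> f = g.
Proof.
move=> cf cg [N [mN N0 fgN]]; apply/funext => x; apply: contrapT => fgx.
have : (f y - g y @[y --> x] --> f x - g x)%R.
  exact: (@cvgB _ R^o _ _ _ f g _ _ (cf x) (cg x)).
move=> /cvgr_neq0; have /[swap] /[apply] : (f x - g x != 0)%R.
  by rewrite subr_eq0; exact/eqP.
move=> /nbhs_ballP[e /= e0 xe].
have /(lebesgue_cv_box_gt0 x) := e0; rewrite ltNge => /negP; apply.
rewrite -N0; apply: le_measure; rewrite ?inE//; first exact: measurable_cv_box.
move=> y xy; apply: fgN => /= fgy.
have /xe : ball x e y by split=> // i j; rewrite (ord1 j); exact: xy.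
by rewrite fgy subrr eqxx.
Qed.

End density_uniqueness.

Section gaussian_law.
Context {R : realType}.

(** [L *m B] is the coisometry relating two factors of one covariance. The defect [X] of the
    factorisation satisfies X X^T = 0, and the diagonal entries of X X^T are sums of squares of
    entries of [X]. *)
Lemma factor_through_left_inverse D K l (B : 'M[R]_(D, l)) (C : 'M[R]_(D, K))
    (L : 'M[R]_(K, D)) :
  L *m C = 1%:M -> B *m B^T = C *m C^T ->
  C *m (L *m B) = B /\ (L *m B) *m (L *m B)^T = 1%:M.
Proof.
move=> LC BC; split; last first.
  rewrite trmx_mul mulmxA -(mulmxA L) BC mulmxA LC mul1mx.
  by rewrite -trmx_mul LC trmx1.
have [X XD] : exists X, X = C *m (L *m B) - B by eexists.
suff : X = 0 by rewrite XD => /eqP; rewrite subr_eq0 => /eqP.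
have XX : X *m X^T = 0.
  have XB : X *m B^T = 0.
    rewrite XD mulmxBl -!mulmxA BC !mulmxA -(mulmxA C L) LC mulmx1.
    exact: subrr.
  by rewrite {2}XD linearB/= mulmxBr XB subr0 mulmxA trmx_mul mulmxA XB mul0mx.
apply/matrixP => i j; rewrite [RHS]mxE.
have /matrixP/(_ i i) := XX; rewrite mxE [RHS]mxE => /eqP.
rewrite psumr_eq0; last by move=> k _; rewrite mxE -expr2 sqr_ge0.
by move=> /allP/(_ j (mem_index_enum j)) /=; rewrite mxE mulf_eq0 orbb => /eqP.
Qed.

Section law.
Variables (D K : nat) (A : 'M[R]_(D, K)) (s : 'I_K -> R).
Variable Q : probability 'cV[R]_D R.
Hypotheses (AA : A^T *m A = 1%:M) (s0 : forall i, 0 < s i).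
Hypothesis QG : is_gaussian Q (A *m diag_mx (\row_i (s i ^+ 2)) *m A^T).

(** With [C = A *m S] and left inverse [S' *m A^T], the arbitrary factor [B] becomes [C] times a
    coisometry, so [Q] is the law of [A S z] with [z] standard normal in dimension [K]. *)
Lemma gaussian_lawE E : measurable E -> Q E =
  (\int[lebesgue_cv K]_z ((\1_E (A *m z))%:E * (normal_pdf_cv s z)%:E))%E.
Proof.
case: QG => l [B [BE QE]] mE; rewrite QE//.
have mB := @measurable_mulmx R D l 1 B.
have mA := @measurable_mulmx R D K 1 A.
pose S := diag_mx (\row_i s i); pose S' := diag_mx (\row_i (s i)^-1).
have S'S : S' *m S = 1%:M.
  rewrite mul_diag_mx; apply/matrixP => i j; rewrite !mxE.
  by have [->|] := eqVneq i j; rewrite ?mulr0// mulr1n mulVf ?gt_eqF.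
have LC : (S' *m A^T) *m (A *m S) = 1%:M.
  by rewrite mulmxA -(mulmxA S') AA mulmx1.
have SS : S *m S^T = diag_mx (\row_i (s i ^+ 2)).
  rewrite tr_diag_mx mul_diag_mx; apply/matrixP => i j; rewrite !mxE.
  by have [->|] := eqVneq i j; rewrite ?mulr0// !mulr1n -expr2.
have BC : B *m B^T = (A *m S) *m (A *m S)^T.
  by rewrite -BE trmx_mul mulmxA -(mulmxA A S) SS.
have [CW WW] := factor_through_left_inverse LC BC.
have mI : measurable_fun setT (fun x : 'cV[R]_D => (\1_E x)%:E : \bar R).
  by apply: measurable_fun_EFin; exact: measurable_indic.
have I0 (x : 'cV[R]_D) : (0 <= (\1_E x)%:E :> \bar R)%E by rewrite lee_fin.
transitivity (\int[std_gaussian l]_z (\1_E (B *m z))%:E)%E.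
  rewrite -[LHS]/(std_gaussian l (mulmx B @^-1` E)) -(setIT (_ @^-1` E)).
  by rewrite -integral_indic// -[X in measurable X]setTI; exact: mB.
transitivity (\int[std_gaussian l]_z
    (\1_E (A *m S *m (S' *m A^T *m B *m z)))%:E)%E.
  by apply: eq_integral => z _; rewrite (mulmxA (A *m S) _ z) CW.
rewrite (ge0_integral_std_gaussian_coisometry
  (f := fun x => (\1_E (A *m S *m x))%:E) WW)//; last first.
  exact: (measurableT_comp mI (@measurable_mulmx R _ _ 1 (A *m S))).
transitivity (\int[std_gaussian K]_z (\1_E (A *m (S *m z)))%:E)%E.
  by apply: eq_integral => z _; rewrite mulmxA.
rewrite (ge0_integral_std_gaussian_diag (f := fun x => (\1_E (A *m x))%:E))//.
exact: (measurableT_comp mI mA).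
Qed.

(** On the column space [A^T] inverts [A], so the density in the coordinate [z] is read off at
    [A^T *m x]. *)
Lemma gaussian_is_density_col_space :
  is_density (lebesgue_col_space A) Q (fun x => normal_pdf_cv s (A^T *m x)).
Proof.
have mA := @measurable_mulmx R D K 1 A.
have mg : measurable_fun setT (fun x => normal_pdf_cv s (A^T *m x)).
  exact: (measurableT_comp (measurable_normal_pdf_cv s)
    (@measurable_mulmx R _ _ 1 A^T)).
split=> //; first by move=> x; exact: normal_pdf_cv_ge0.
move=> E mE; rewrite gaussian_lawE// ge0_integral_pushforward//; last 2 first.
- exact/measurable_funTS/measurable_fun_EFin.
- by move=> x _; rewrite lee_fin normal_pdf_cv_ge0.
rewrite [RHS]integral_mkcond; apply: eq_integral => z _.
rewrite patchE indicE -[z \in _ @^-1` _]/(A *m z \in E).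
by case: ifP => _; rewrite ?mul0e// mul1e /= mulmxA AA mul1mx.
Qed.

End law.

Lemma gaussian_is_density n (U : 'M[R]_n) (s : 'I_n -> R)
    (P : probability 'cV[R]_n R) :
  U^T *m U = 1%:M -> (forall i, 0 < s i) ->
  is_gaussian P (U *m diag_mx (\row_i (s i ^+ 2)) *m U^T) ->
  is_density (lebesgue_cv n) P (fun x => normal_pdf_cv s (U^T *m x)).
Proof.
move=> UU s0 PG.
have mg : measurable_fun setT (fun x => normal_pdf_cv s (U^T *m x)).
  exact: (measurableT_comp (measurable_normal_pdf_cv s)
    (@measurable_mulmx R _ _ 1 U^T)).
split=> //; first by move=> x; exact: normal_pdf_cv_ge0.
move=> E mE; rewrite (gaussian_lawE UU s0 PG)//.
rewrite [RHS]integral_mkcond.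
rewrite -[RHS](ge0_integral_lebesgue_cv_orthogonal UU)//.
- apply: eq_integral => z _; rewrite patchE indicE; case: ifPn => _.
    by rewrite mul1e mulmxA UU mul1mx.
  by rewrite mul0e.
- have mEg := measurable_funTS (D := E) (measurable_fun_EFin mg).
  exact: (measurable_restrictT _ mE).1 mEg.
- move=> x; rewrite erestrict_ge0// => y _.
  by rewrite lee_fin normal_pdf_cv_ge0.
Qed.

Lemma continuous_normal_pdf_cv_mulmx m n (A : 'M[R]_(n, m)) (s : 'I_n -> R) :
  (forall i, s i != 0) ->
  continuous (fun x : 'cV[R]_m => normal_pdf_cv s (A *m x)).
Proof.
move=> s0; have cm i : continuous (fun x : 'cV[R]_m => (A *m x) i 0).
  rewrite (_ : (fun x : 'cV[R]_m => (A *m x) i 0) =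
    (fun x : 'cV[R]_m => \sum_k A i k * x k 0)); last first.
    by apply/funext => x; rewrite mxE.
  apply: continuous_big; first exact: add_continuous.
  move=> k _ x; apply: (@cvgM _ _ (nbhs x) _ (fun=> A i k)
    (fun x : 'cV[R]_m => x k 0)); [exact: cvg_cst|exact: coord_continuous].
apply: continuous_big; first exact: mul_continuous.
move=> i _ x.
apply: (@continuous_comp _ _ _ (fun x : 'cV[R]_m => (A *m x) i 0)).
  exact: cm.
exact: continuous_normal_pdf.
Qed.

Lemma continuous_densityE D (P : probability 'cV[R]_D R) (p : 'cV[R]_D -> R) :
  continuous p -> is_density (lebesgue_cv D) P p -> continuous_density P = p.
Proof.
move=> cp dp; rewrite /continuous_density.
have [cg dg] : [set p | continuous p /\ is_density (lebesgue_cv D) P p]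
  (get [set p | continuous p /\ is_density (lebesgue_cv D) P p]).
  by apply: getPex; exists p.
by apply: continuous_ae_eq => //; exact: is_density_ae_eq dg dp.
Qed.

End gaussian_law.

(** * Quasi-KL divergence as an expectation of quadratic forms *)

Section quasi_kl.
Context {R : realType}.

(** For positive [s], the logarithm of [normal_pdf_cv s] at the origin. *)
Definition log_normalizer n (s : 'I_n -> R) : R :=
  ln (normal_peak 1) *+ n - \sum_i ln (s i).

Lemma ln_prod (I : Type) (r : seq I) (s : I -> R) :
  (forall i, 0 < s i) -> ln (\prod_(i <- r) s i) = \sum_(i <- r) ln (s i).
Proof.
move=> s0; elim: r => [|i r IH]; first by rewrite !big_nil ln1.
by rewrite !big_cons lnM ?posrE ?prodr_gt0// IH.
Qed.

Lemma ln_normal_pdf_cv n (s : 'I_n -> R) (x : 'cV[R]_n) :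
  (forall i, 0 < s i) ->
  let y := diag_mx (\row_i (s i)^-1) *m x in
  ln (normal_pdf_cv s x) = log_normalizer s - 2^-1 * (y^T *m y) 0 0.
Proof.
move=> s0 y; have xE : x = diag_mx (\row_i s i) *m y.
  rewrite /y mul_diag_mx; apply/colP => i; rewrite !mxE (bigD1 i)//= big1.
    by rewrite !mxE eqxx addr0 mulVKf ?gt_eqF.
  by move=> j ij; rewrite !mxE eq_sym (negbTE ij) mul0r.
have p0 : 0 < normal_peak 1 :> R by rewrite normal_peak_gt0 ?oner_eq0.
rewrite {1}xE normal_pdf_cv_diag// normal_pdf_cv1E.
rewrite lnM ?posrE ?invr_gt0 ?prodr_gt0 ?mulr_gt0 ?exprn_gt0 ?expR_gt0//.
rewrite lnM ?posrE ?exprn_gt0 ?expR_gt0// expRK lnXn// lnV ?posrE ?prodr_gt0//.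
by rewrite ln_prod// /log_normalizer; ring.
Qed.

Section quadratic_moments.
Variables (K : nat) (s : 'I_K -> R).
Hypothesis s0 : forall i, 0 < s i.
Local Notation g := (normal_pdf_cv s).
Local Notation S := (diag_mx (\row_i s i)).

Lemma measurable_sqnorm_mulmx m (N : 'M[R]_(m, K)) :
  measurable_fun setT (fun z : 'cV[R]_K => ((N *m z)^T *m (N *m z)) 0 0).
Proof.
under eq_fun do rewrite sqnorm_cvE.
apply: measurable_sum => i; apply: measurable_funX.
have mc := measurableT_comp (@measurable_coord R m 1 i 0)
  (@measurable_mulmx R _ _ 1 N).
exact: mc.
Qed.

Lemma integral_sqnorm_normal_pdf_cv m (N : 'M[R]_(m, K)) :
  (\int[lebesgue_cv K]_z (((N *m z)^T *m (N *m z)) 0 0 * g z)%:E =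
   (\tr ((N *m S) *m (N *m S)^T))%:E)%E.
Proof.
rewrite -integral_std_gaussian_sqnorm.
under eq_integral do rewrite EFinM.
rewrite -(ge0_integral_std_gaussian_diag
  (f := fun z => (((N *m z)^T *m (N *m z)) 0 0)%:E))//.
- by apply: eq_integral => z _; rewrite (mulmxA N).
- exact: (measurable_fun_EFin (measurable_sqnorm_mulmx N)).
- by move=> z; rewrite lee_fin sqnorm_cv_ge0.
Qed.

Lemma integrable_sqnorm_normal_pdf_cv m (N : 'M[R]_(m, K)) :
  (lebesgue_cv K).-integrable setT
    (fun z => (((N *m z)^T *m (N *m z)) 0 0 * g z)%:E).
Proof.
apply: ge0_integral_lty_integrable.
- apply: measurable_funM; first exact: measurable_sqnorm_mulmx.
  exact: measurable_normal_pdf_cv.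
- by move=> z; rewrite mulr_ge0 ?sqnorm_cv_ge0 ?normal_pdf_cv_ge0.
- by rewrite integral_sqnorm_normal_pdf_cv ltry.
Qed.

Lemma integrable_normal_pdf_cv :
  (lebesgue_cv K).-integrable setT (fun z => (g z)%:E).
Proof.
apply: ge0_integral_lty_integrable.
- exact: measurable_normal_pdf_cv.
- by move=> z; rewrite normal_pdf_cv_ge0.
- by rewrite integral_normal_pdf_cv ltry.
Qed.

Variables (m1 m2 : nat) (N1 : 'M[R]_(m1, K)) (N2 : 'M[R]_(m2, K)) (a b1 b2 : R).
Local Notation q1 z := (((N1 *m z)^T *m (N1 *m z)) 0 0).
Local Notation q2 z := (((N2 *m z)^T *m (N2 *m z)) 0 0).
(** The integrand split into three integrable summands, the form in which linearity of the integral
    applies. *)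
Let F z :=
  (a%:E * (g z)%:E + b1%:E * (q1 z * g z)%:E + b2%:E * (q2 z * g z)%:E)%E.

Let FE z : F z = (g z * (a + b1 * q1 z + b2 * q2 z))%:E.
Proof. by rewrite /F -!EFinM -!EFinD; congr EFin; ring. Qed.

Let iF : (lebesgue_cv K).-integrable setT F.
Proof.
apply: integrableD => //; first apply: integrableD => //;
  apply: integrableZl => //.
- exact: integrable_normal_pdf_cv.
- exact: integrable_sqnorm_normal_pdf_cv.
- exact: integrable_sqnorm_normal_pdf_cv.
Qed.

Lemma integrable_quadratic_normal_pdf_cv : (lebesgue_cv K).-integrable setT
  (fun z => (g z * (a + b1 * q1 z + b2 * q2 z))%:E).
Proof. by apply: eq_integrable iF => // z _; exact: FE. Qed.

Lemma integral_quadratic_normal_pdf_cv :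
  (\int[lebesgue_cv K]_z (g z * (a + b1 * q1 z + b2 * q2 z))%:E =
  (a + b1 * \tr ((N1 *m S) *m (N1 *m S)^T)
     + b2 * \tr ((N2 *m S) *m (N2 *m S)^T))%:E)%E.
Proof.
have i0 := integrable_normal_pdf_cv.
have i1 := integrable_sqnorm_normal_pdf_cv N1.
have i2 := integrable_sqnorm_normal_pdf_cv N2.
transitivity (\int[lebesgue_cv K]_z F z)%E.
  by apply: eq_integral => z _; rewrite FE.
rewrite integralD//; last 2 first.
- by apply: integrableD => //; exact: integrableZl.
- exact: integrableZl.
rewrite integralD//; [|exact: integrableZl..].
rewrite !integralZl// integral_normal_pdf_cv !integral_sqnorm_normal_pdf_cv.
by rewrite mule1.
Qed.

End quadratic_moments.

(** [A *m A^T] is the orthogonal projection onto the column space, which is thus cut out by finitely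
    many linear equations. *)
Lemma measurable_col_space D K (A : 'M[R]_(D, K)) : A^T *m A = 1%:M ->
  measurable (col_space A).
Proof.
move=> AA; pose N := A *m A^T - 1%:M.
rewrite (_ : col_space A =
    \bigcap_(i in [set: 'I_D]) ((fun x => (N *m x) i 0) @^-1` [set 0])).
  apply: fin_bigcap_measurable => // i _; rewrite -[X in measurable X]setTI.
  have mN := measurableT_comp (@measurable_coord R D 1 i 0)
    (@measurable_mulmx R _ _ 1 N).
  exact: mN.
apply/seteqP; split => [x [z _ <-] i _|x Nx].
  by rewrite /preimage/= mulmxBl mul1mx mulmxA -(mulmxA A) AA mulmx1 subrr mxE.
exists (A^T *m x) => //; rewrite mulmxA.
apply/eqP; rewrite -subr_eq0 -{2}[x]mul1mx -mulmxBl; apply/eqP/colP => i.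
by rewrite [RHS]mxE; exact: Nx.
Qed.

Lemma qkl_gaussian D K (A : 'M[R]_(D, K)) (s : 'I_K -> R) (U : 'M[R]_D)
    (t : 'I_D -> R) (Q P : probability 'cV[R]_D R) :
  A^T *m A = 1%:M -> (forall i, 0 < s i) ->
  is_gaussian Q (A *m diag_mx (\row_i (s i ^+ 2)) *m A^T) ->
  U^T *m U = 1%:M -> (forall i, 0 < t i) ->
  is_gaussian P (U *m diag_mx (\row_i (t i ^+ 2)) *m U^T) ->
  let M := diag_mx (\row_i (t i)^-1) *m U^T *m A *m diag_mx (\row_i s i) in
  qkl A Q P = (log_normalizer s - log_normalizer t
                 + 2^-1 * \tr (M *m M^T) - 2^-1 * K%:R)%:E.
Proof.
move=> AA s0 QG UU t0 PG M.
have pd := gaussian_is_density UU t0 PG.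
have pE : continuous_density P = fun x => normal_pdf_cv t (U^T *m x).
  apply: continuous_densityE => //; apply: continuous_normal_pdf_cv_mulmx => i.
  by rewrite gt_eqF.
have qd' := gaussian_is_density_col_space AA s0 QG.
have qd : is_density (lebesgue_col_space A) Q (subspace_density A Q).
  by apply: getPex; eexists; exact: qd'.
have mA := @measurable_mulmx R D K 1 A.
have mcol := measurable_col_space AA.
rewrite /qkl pE; cbv zeta.
set q := subspace_density A Q in qd *.
set q' := (fun x => normal_pdf_cv s (A^T *m x)) in qd'.
set p := (fun x => normal_pdf_cv t (U^T *m x)) in pd.
have p0 x : 0 < p x by apply: normal_pdf_cv_gt0 => i; rewrite gt_eqF.
have [mq q0 _] := qd; have [mq' _ _] := qd'; have [mp _ _] := pd.
have mint (h : 'cV[R]_D -> R) : measurable_fun setT h ->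
    measurable_fun setT (fun x => (h x * (ln (h x) - ln (p x)))%:E).
  move=> mh; apply: measurable_fun_EFin; apply: measurable_funM => //.
  by apply: measurable_funB; apply: (measurableT_comp (@measurable_ln R)).
(* As [p] is positive, the extended logarithm of the quotient is a difference of real logarithms
   wherever [q] is positive; where [q = 0] both integrands vanish. *)
transitivity (\int[lebesgue_col_space A]_(x in col_space A)
    (q x * (ln (q x) - ln (p x)))%:E)%E.
  apply: eq_integral => // x _.
  have := q0 x; rewrite le_eqVlt => /predU1P[qx0|qx0].
    by rewrite -qx0 mul0e mul0r.
  rewrite inver (gt_eqF (p0 x)) -!EFinM lne_EFin ?divr_gt0// ?p0//.
  by rewrite ln_div ?posrE ?p0.
transitivity (\int[lebesgue_col_space A]_(x in col_space A)
    (q' x * (ln (q' x) - ln (p x)))%:E)%E.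
  apply: (@ae_eq_integral _ _ _ (pushforward (lebesgue_cv K) (mulmx A))) => //.
  - exact: (measurable_funTS (mint _ mq)).
  - exact: (measurable_funTS (mint _ mq')).
  (* The pushforward is packaged as a measure, with [mA] as measurability proof, so that uniqueness
     of densities applies to it. *)
  pose lam : {measure set 'cV[R]_D -> \bar R} :=
    measure_function_pushforward__canonical__measure_function_Measure
      (lebesgue_cv K) mA.
  have : {ae lam, forall x, q x = q' x} by exact: is_density_ae_eq qd qd'.
  by apply: filterS => x /= -> _.
pose N2 : 'M[R]_K := diag_mx (\row_i (s i)^-1).
pose N1 := diag_mx (\row_i (t i)^-1) *m U^T *m A.
have hE z : q' (A *m z) * (ln (q' (A *m z)) - ln (p (A *m z))) =
    normal_pdf_cv s z * (log_normalizer s - log_normalizer t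
     + 2^-1 * ((N1 *m z)^T *m (N1 *m z)) 0 0
     + (- 2^-1) * ((N2 *m z)^T *m (N2 *m z)) 0 0).
  rewrite /q' /p mulmxA AA mul1mx; congr (_ * _).
  rewrite !ln_normal_pdf_cv// -/N2 !mulmxA -/N1; lra.
have preim : mulmx A @^-1` col_space A = setT.
  by apply/seteqP; split => // z _; exists z.
rewrite integral_pushforward//; last 2 first.
- exact: mint.
- rewrite preim.
  apply: eq_integrable (integrable_quadratic_normal_pdf_cv s0 N1 N2
    (log_normalizer s - log_normalizer t) 2^-1 (- 2^-1)) => // z _.
  by rewrite /= hE.
rewrite preim; transitivity (\int[lebesgue_cv K]_z
   (normal_pdf_cv s z * (log_normalizer s - log_normalizer t
     + 2^-1 * ((N1 *m z)^T *m (N1 *m z)) 0 0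
     + (- 2^-1) * ((N2 *m z)^T *m (N2 *m z)) 0 0))%:E)%E.
  by apply: eq_integral => z _; rewrite /= hE.
rewrite integral_quadratic_normal_pdf_cv// -/M; congr EFin.
(* [N2] whitens [Q], so its quadratic form has expectation [K]; this is the origin of the term - K /
   2. *)
have -> : N2 *m diag_mx (\row_i s i) = 1%:M.
  rewrite mul_diag_mx; apply/matrixP => i j; rewrite !mxE.
  by have [->|] := eqVneq i j; rewrite ?mulr0// mulr1n mulVf ?gt_eqF.
by rewrite trmx1 mulmx1 mxtrace1 mulNr.
Qed.

End quasi_kl.

(** * Optimisation over orthonormal frames *)

Section spectral_ordering.
Context {R : rcfType}.

Lemma char_poly_similar n (U V A : 'M[R]_n) : U *m V = 1%:M ->
  char_poly (U *m A *m V) = char_poly A.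
Proof.
move=> UV; rewrite /char_poly /char_poly_mx.
have -> : 'X%:M - map_mx polyC (U *m A *m V) =
    map_mx polyC U *m ('X%:M - map_mx polyC A) *m map_mx polyC V.
  rewrite mulmxBr mulmxBl -!map_mxM/=; congr (_ - _).
  by rewrite mul_mx_scalar -scalemxAl -map_mxM UV map_mx1 scalemx1.
by rewrite !det_mulmx mulrAC -det_mulmx -map_mxM UV map_mx1 det1 mul1r.
Qed.

Lemma char_poly_diag n (d : 'rV[R]_n) :
  char_poly (diag_mx d) = \prod_i ('X - (d 0 i)%:P).
Proof.
rewrite char_poly_trig; last exact: diag_mx_is_trig.
by apply: eq_bigr => i _; rewrite mxE eqxx.
Qed.

Theorem sorted_spectral n (S : 'M[R]_n) : S^T = S ->
  exists (U : 'M[R]_n) (d : 'rV[R]_n),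
    [/\ U^T *m U = 1%:M, S = U *m diag_mx d *m U^T &
        sorted >=%R [seq d 0 i | i : 'I_n]].
Proof.
move=> /real_spectral[U [d [UU SE]]].
pose s := sort >=%R [seq d 0 i | i : 'I_n].
have ss : size s == n by rewrite size_sort size_map size_enum_ord.
have /tuple_permP[p pE] : perm_eq (Tuple ss) [tuple d 0 i | i < n].
  by rewrite /= /s perm_sort.
exists (col_perm p U), (col_perm p d).
have DE : diag_mx (col_perm p d) = perm_mx p *m diag_mx d *m (perm_mx p)^T.
  rewrite tr_perm_mx; apply/matrixP => i j.
  rewrite -col_permE -row_permE !mxE.
  by rewrite (inj_eq perm_inj).
have UE : col_perm p U = U *m (perm_mx p)^T by rewrite col_permE tr_perm_mx.
have PP : (perm_mx p)^T *m perm_mx p = 1%:M :> 'M[R]_n.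
  by rewrite tr_perm_mx -perm_mxM mulVg perm_mx1.
have PP' : perm_mx p *m (perm_mx p)^T = 1%:M :> 'M[R]_n.
  by rewrite tr_perm_mx -perm_mxM mulgV perm_mx1.
split.
- by rewrite UE trmx_mul trmxK mulmxA -(mulmxA _ U^T) UU mulmx1.
- rewrite UE DE trmx_mul trmxK !mulmxA -(mulmxA U) PP mulmx1.
  by rewrite -(mulmxA (U *m diag_mx d)) PP mulmx1.
- have -> : [seq col_perm p d 0 i | i : 'I_n] = s.
    rewrite -[s]/(tval (Tuple ss)) pE /=; apply: eq_map => i.
    by rewrite mxE tnth_mktuple.
  by apply: sort_sorted => x y; rewrite /= le_total.
Qed.

Lemma char_poly_spectral n (S U : 'M[R]_n) (d : 'rV[R]_n) :
  U^T *m U = 1%:M -> S = U *m diag_mx d *m U^T ->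
  char_poly S = \prod_(x <- [seq d 0 i | i : 'I_n]) ('X - x%:P).
Proof.
move=> UU ->; rewrite char_poly_similar; last exact: mulmx1C.
by rewrite char_poly_diag big_map big_enum.
Qed.

End spectral_ordering.

Section optimum.
Context {R : realType}.

(** Each eigenvalue is the value of the quadratic form at the corresponding unit column of [U]. *)
Lemma posdef_spectral_gt0 n (S U : 'M[R]_n) (d : 'rV[R]_n) :
  posdef S -> U^T *m U = 1%:M -> S = U *m diag_mx d *m U^T ->
  forall i, 0 < d 0 i.
Proof.
move=> [_ S0] UU SE i.
have ui0 : col i U != 0.
  apply/eqP => u0; have /matrixP/(_ i i) := UU.
  rewrite !mxE eqxx big1 => [/eqP|k _]; first by rewrite eq_sym oner_eq0.
  by have /matrixP/(_ k 0) := u0; rewrite !mxE => ->; rewrite mulr0.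
have := S0 _ ui0.
have -> : (col i U)^T *m S *m col i U = (d 0 i)%:M.
  rewrite SE colE trmx_mul !mulmxA -(mulmxA _ U^T U) UU mulmx1.
  rewrite -(mulmxA _ U^T U) UU mulmx1 -mulmxA.
  rewrite mul_diag_mx; apply/matrixP => j k.
  rewrite !ord1 !mxE (bigD1 i)//= !mxE !eqxx mulr1 mul1r big1 ?addr0//.
  by move=> l li; rewrite !mxE (negbTE li) !mul0r.
by rewrite mxE.
Qed.

(** With a threshold [c] between the first [m] values and the others, every product (t_i - [i < m])
    (x_i - c) is at most 0, and the differences t_i - [i < m] sum to 0. *)
Lemma sum_weighted_le_top n m (x t : 'I_n -> R) :
  (m <= n)%N -> {homo x : i j / (i <= j)%N >-> j <= i} ->
  (forall i, 0 <= t i <= 1) -> \sum_i t i = m%:R ->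
  \sum_i t i * x i <= \sum_(i < n | (i < m)%N) x i.
Proof.
case: n x t => [|n] x t; first by rewrite !big_ord0.
move=> mn xh t01 tm.
(* The least of the first [m] values; for [m = 0] this is the greatest value of all, which is still
   a valid threshold. *)
pose c := x (inord m.-1).
have h i : t i * x i - (if (i < m)%N then x i else 0) <=
    c * (t i - (if (i < m)%N then 1 else 0)).
  have /andP[t0 t1] := t01 i.
  case: ifPn => im.
    have xc : c <= x i.
      by apply: xh; rewrite inordK; lia.
    nra.
  rewrite -leqNgt in im.
  rewrite !subr0 mulrC ler_wpM2r// xh// inordK; lia.
rewrite [leRHS]big_mkcond/= -subr_le0 -sumrB.
apply: le_trans (ler_sum _ (fun i _ => h i)) _.
rewrite -mulr_sumr sumrB tm -big_mkcond/= sumr_const.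
have -> : #|[pred i : 'I_n.+1 | (i < m)%N]| = m.
  by rewrite -sum1_card /= -(big_ord_widen _ (fun=> 1%N) mn) sum1_card card_ord.
by rewrite subrr mulr0.
Qed.

Lemma sorted_ord_homo n (x : 'I_n -> R) :
  sorted >=%R [seq x i | i : 'I_n] -> {homo x : i j / (i <= j)%N >-> j <= i}.
Proof.
move=> xs i j ij.
have nthE (k : 'I_n) : nth 0 [seq x i | i : 'I_n] k = x k.
  by rewrite (nth_map k) ?size_enum_ord// nth_ord_enum.
have ltE (k : 'I_n) : (k < size [seq x i | i : 'I_n])%N.
  by rewrite size_map size_enum_ord.
rewrite -(nthE i) -(nthE j).
exact: (sorted_leq_nth ge_trans ge_refl 0 xs _ _ (ltE i) (ltE j) ij).
Qed.

Lemma take_enum_ord n m : (m <= n)%N ->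
  take m (enum 'I_n) = [seq i : 'I_n <- enum 'I_n | (i < m)%N].
Proof.
move=> mn; apply: (inj_map val_inj).
rewrite map_take val_enum_ord take_iota (minn_idPl mn).
rewrite -(filter_map val (fun i => (i < m)%N)) val_enum_ord.
exact: esym (filter_iota_ltn 0 mn).
Qed.

Lemma take_enum_widen n m (mn : (m <= n)%N) :
  take m (enum 'I_n) = [seq widen_ord mn i | i <- enum 'I_m].
Proof.
apply: (inj_map val_inj).
rewrite map_take val_enum_ord take_iota (minn_idPl mn).
by rewrite -map_comp -val_enum_ord.
Qed.

Lemma sum_take_enum n m (x : 'I_n -> R) (g : R -> R) : (m <= n)%N ->
  \sum_(y <- take m [seq x i | i : 'I_n]) g y =
  \sum_(i < n | (i < m)%N) g (x i).
Proof.
move=> mn; rewrite -map_take take_enum_ord// big_map big_filter.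
by rewrite big_enum_cond.
Qed.

(** Bessel's inequality: [N = W *m W^T] is a symmetric idempotent, so N_ii is the sum of the squares
    of its row, whence N_ii^2 <= N_ii. *)
Lemma coisometry_row_sqnorm_le1 n m (W : 'M[R]_(n, m)) i :
  W^T *m W = 1%:M -> \sum_k W i k ^+ 2 <= 1.
Proof.
move=> WW; have [N ND] : exists N, N = W *m W^T by eexists.
have NE j : N i j = N j i.
  by rewrite ND !mxE; apply: eq_bigr => k _; rewrite !mxE mulrC.
have NN : N *m N = N by rewrite ND mulmxA -(mulmxA W) WW mulmx1.
have -> : \sum_k W i k ^+ 2 = N i i.
  by rewrite ND mxE; apply: eq_bigr => k _; rewrite mxE expr2.
have : N i i ^+ 2 <= N i i.
  rewrite -{2}NN mxE (bigD1 i)//= -expr2 lerDl sumr_ge0// => j _.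
  by rewrite -NE -expr2 sqr_ge0.
by nra.
Qed.

Lemma invmx_spectral n (S U : 'M[R]_n) (d : 'rV[R]_n) :
  (forall i, 0 < d 0 i) -> U^T *m U = 1%:M -> S = U *m diag_mx d *m U^T ->
  S \in unitmx /\ invmx S = U *m diag_mx (\row_i (d 0 i)^-1) *m U^T.
Proof.
move=> d0 UU SE; set T := U *m _ *m U^T.
have ST : S *m T = 1%:M.
  rewrite SE /T !mulmxA -(mulmxA _ U^T U) UU mulmx1 -(mulmxA U).
  rewrite [X in U *m X](_ : _ = 1%:M) ?mulmx1; first exact: mulmx1C.
  rewrite mul_diag_mx; apply/matrixP => i j; rewrite !mxE.
  by have [->|] := eqVneq i j; rewrite ?mulr0// mulr1n divff ?gt_eqF.
have [Su _] := mulmx1_unit ST; split => //.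
by rewrite -[T](mulKmx Su) ST mulmx1.
Qed.

(* For V > 0 and each eigenvalue x, V / x - ln V >= 1 - ln x; averaging over the
   spectrum with the weights W i k ^+ 2 avoids any determinant inequality. *)
Lemma objective_lower_bound D K (S U : 'M[R]_D) (d : 'rV[R]_D)
    (A : 'M[R]_(D, K)) (v : 'I_K -> R) :
  (forall i, 0 < d 0 i) -> {homo d 0 : i j / (i <= j)%N >-> j <= i} ->
  U^T *m U = 1%:M -> S = U *m diag_mx d *m U^T ->
  A^T *m A = 1%:M -> (forall k, 0 < v k) ->
  K%:R - \sum_(i < D | (i < K)%N) ln (d 0 i) <=
  \sum_k ((A^T *m invmx S *m A) k k * v k - ln (v k)).
Proof.
move=> d0 dS UU SE AA v0.
have [W WD] : exists W, W = U^T *m A by eexists.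
have WW : W^T *m W = 1%:M.
  by rewrite WD trmx_mul trmxK mulmxA -(mulmxA A^T) (mulmx1C UU) mulmx1.
have Wk k : \sum_i W i k ^+ 2 = 1.
  have /matrixP/(_ k k) := WW; rewrite !mxE eqxx mulr1n => <-.
  by apply: eq_bigr => i _; rewrite mxE expr2.
have bE k : (A^T *m invmx S *m A) k k = \sum_i W i k ^+ 2 / d 0 i.
  have [_ ->] := invmx_spectral d0 UU SE.
  rewrite !mulmxA -(mulmxA _ U^T A) -WD -[A^T *m U]trmxK trmx_mul trmxK -WD.
  rewrite mul_mx_diag mxE; apply: eq_bigr => i _; rewrite !mxE.
  by rewrite mulrAC expr2.
have KD : (K <= D)%N by exact: mulmx1_min WW.
have step k : \sum_i W i k ^+ 2 * (1 - ln (d 0 i)) <=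
    (A^T *m invmx S *m A) k k * v k - ln (v k).
  (* Since the weights of column [k] sum to 1, [ln (v k)] is spread over the spectrum and the
     comparison becomes termwise. *)
  rewrite bE mulr_suml -[ln (v k)]mul1r -[X in X * ln (v k)](Wk k).
  rewrite mulr_suml -sumrB.
  apply: ler_sum => i _; rewrite -mulrA -mulrBr ler_wpM2l ?sqr_ge0//.
  have r0 : 0 < v k / d 0 i by rewrite divr_gt0.
  (* The scalar inequality is ln (1 + y) <= y at y = v k / d 0 i - 1. *)
  have r1 : -1 < v k / d 0 i - 1 by rewrite ltrBrDl subrr.
  have := le_ln1Dx r1; rewrite [1 + _]addrC subrK ln_div ?posrE//.
  rewrite [_^-1 * _]mulrC.
  move: (v k / _) => r; lra.
apply: le_trans (ler_sum _ (fun k _ => step k)).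
rewrite exchange_big/=.
under [leRHS]eq_bigr do rewrite -mulr_suml mulrBr mulr1.
have tK : \sum_i \sum_k W i k ^+ 2 = K%:R.
  by rewrite exchange_big/= (eq_bigr (fun=> 1)) ?sumr_const ?card_ord.
rewrite sumrB tK lerD2l lerN2.
apply: (sum_weighted_le_top (x := fun i => ln (d 0 i))) => //.
- by move=> i j ij; rewrite ler_ln ?posrE// dS.
- move=> i; rewrite coisometry_row_sqnorm_le1// andbT.
  by rewrite sumr_ge0// => k _; rewrite sqr_ge0.
Qed.

End optimum.

(** * The QKL formula and the top eigenvectors *)

Section assembly.
Context {R : realType}.

Lemma admissible_diag_gt0 D K (A : 'M[R]_(D, K)) (V : 'M[R]_K) :
  admissible A V -> (forall k, 0 < V k k) /\ V = diag_mx (\row_k V k k).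
Proof.
move=> [_ /is_diag_mxP Vd [_ V0]]; split.
  move=> k; have /V0 : delta_mx k 0 != 0 :> 'cV[R]_K.
    by apply/eqP => /matrixP/(_ k 0)/eqP; rewrite !mxE !eqxx oner_eq0.
  by rewrite trmx_delta -rowE -colE !mxE.
apply/matrixP => i j; rewrite !mxE.
by have [->|ij] := eqVneq i j; rewrite ?mulr1n// mulr0n Vd.
Qed.

Lemma top_eigenvectors_admissible D K (S : 'M[R]_D) (A : 'M[R]_(D, K)) e :
  posdef S -> top_eigenvectors S A e -> admissible A (diag_mx e).
Proof.
move=> [_ S0] [AA Ae _]; split=> //; split; first exact: tr_diag_mx.
have Ak k : (col k A)^T *m col k A = 1%:M.
  have /matrixP/(_ k k) := AA; rewrite !mxE eqxx => Akk.
  apply/matrixP => i j; rewrite !ord1 !mxE eqxx -Akk.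
  by apply: eq_bigr => l _; rewrite !mxE.
have e0 k : 0 < e 0 k.
  have : col k A != 0.
    apply/eqP => Ak0; have := Ak k; rewrite Ak0 mulmx0 => /matrixP/(_ 0 0)/eqP.
    by rewrite !mxE eq_sym oner_eq0.
  by move=> /S0; rewrite -mulmxA Ae -scalemxAr Ak !mxE mulr1.
move=> x x0; rewrite -mulmxA mul_diag_mx mxE.
rewrite (eq_bigr (fun k => e 0 k * x k 0 ^+ 2)); last first.
  by move=> k _; rewrite !mxE expr2 mulrCA.
have ge0 k : 0 <= e 0 k * x k 0 ^+ 2 by rewrite mulr_ge0 ?sqr_ge0 ?ltW.
rewrite lt0r sumr_ge0// andbT psumr_neq0//.
have [k xk] : exists k, x k 0 != 0.
  apply/existsP; apply: contraNT x0 => /existsPn x0; apply/eqP/colP => k.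
  by rewrite mxE; apply/eqP; have := x0 k; rewrite negbK.
apply/hasP; exists k; first exact: mem_index_enum.
by rewrite /= mulr_gt0// exprn_even_gt0.
Qed.

(** The square roots of [V k k] and of the eigenvalues of [S] serve as standard deviations; the
    constant involves only [K] and the eigenvalues. *)
Lemma qkl_gaussian_formula D (S U : 'M[R]_D) (d : 'rV[R]_D)
    (P : probability 'cV[R]_D R) K :
  (forall i, 0 < d 0 i) -> U^T *m U = 1%:M -> S = U *m diag_mx d *m U^T ->
  is_gaussian P S ->
  forall (A : 'M[R]_(D, K)) (V : 'M[R]_K) (Q : probability 'cV[R]_D R),
    admissible A V -> is_gaussian Q (A *m V *m A^T) ->
    qkl A Q P = (ln (normal_peak 1) *+ K
        - log_normalizer (fun i => Num.sqrt (d 0 i)) - 2^-1 * K%:R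
      - 2^-1 * (\sum_k ln (V k k)) + 2^-1 * \tr (A^T *m invmx S *m A *m V))%:E.
Proof.
move=> d0 UU SE PG A V Q adm QG.
have [AA _ _] := adm; have [V0 VE] := admissible_diag_gt0 adm.
pose s k := Num.sqrt (V k k); pose t i := Num.sqrt (d 0 i).
have s0 k : 0 < s k by rewrite sqrtr_gt0.
have t0 i : 0 < t i by rewrite sqrtr_gt0.
have s2 k : s k ^+ 2 = V k k by rewrite sqr_sqrtr ?ltW.
have t2 i : t i ^+ 2 = d 0 i by rewrite sqr_sqrtr ?ltW.
have VE2 : V = diag_mx (\row_k s k ^+ 2).
  by rewrite {1}VE; congr diag_mx; apply/rowP => k; rewrite !mxE s2.
have dE2 : d = \row_i t i ^+ 2 by apply/rowP => i; rewrite !mxE t2.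
rewrite VE2 in QG; rewrite SE dE2 in PG.
rewrite (qkl_gaussian AA s0 QG UU t0 PG); congr EFin.
have [_ SV] := invmx_spectral d0 UU SE.
have -> : \sum_k ln (V k k) = 2 * \sum_k ln (s k).
  by rewrite mulr_sumr; apply: eq_bigr => k _; rewrite -s2 lnXn// mulr_natl.
set M := diag_mx _ *m _ *m _ *m _.
have -> : \tr (M *m M^T) = \tr (A^T *m invmx S *m A *m V).
  have diag2 n (r : 'I_n -> R) : diag_mx (\row_i r i) *m diag_mx (\row_i r i) =
      diag_mx (\row_i r i ^+ 2).
    rewrite mul_diag_mx; apply/matrixP => i j; rewrite !mxE.
    by have [->|] := eqVneq i j; rewrite ?mulr0// !mulr1n -expr2.
  (* [V] is split as a square, and cyclicity of the trace moves one root to the other side. *)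
  rewrite VE2 -diag2 mulmxA mxtrace_mulC [RHS]mxtrace_mulC; congr (\tr _).
  rewrite SV /M !trmx_mul trmxK !tr_diag_mx !mulmxA.
  congr (_ *m _ *m _); rewrite -!mulmxA; congr (_ *m (_ *m (_ *m _))).
  rewrite !mulmxA diag2; congr (_ *m _); congr diag_mx.
  by apply/rowP => i; rewrite !mxE exprVn t2.
rewrite /log_normalizer -/t; lra.
Qed.

(** The characteristic polynomial determines the multiset of its roots and sorting fixes their
    order, so the list in [top_eigenvectors] is the list of entries of [d]. *)
Lemma top_eigenvectors_sum_ln D K (S U : 'M[R]_D) (d : 'rV[R]_D)
    (A : 'M[R]_(D, K)) (e : 'rV[R]_K) :
  U^T *m U = 1%:M -> S = U *m diag_mx d *m U^T ->
  sorted >=%R [seq d 0 i | i : 'I_D] -> top_eigenvectors S A e ->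
  \sum_k ln (e 0 k) = \sum_(i < D | (i < K)%N) ln (d 0 i).
Proof.
move=> UU SE dS [AA _ [r [rS rs er]]].
have KD : (K <= D)%N by exact: mulmx1_min AA.
have rd : r = [seq d 0 i | i : 'I_D].
  apply: (sorted_eq ge_trans ge_anti rs dS).
  by apply: prod_XsubC_eq; rewrite -rS; exact: (char_poly_spectral UU SE).
rewrite -(sum_take_enum (d 0) (@ln R) KD) -rd -(perm_big _ er)/=.
by rewrite big_map big_enum.
Qed.

(** The eigenvector equations say [S *m A = A *m diag_mx e], so the matrix under the trace is
    [A^T *m A], the identity. *)
Lemma top_eigenvectors_trace D K (S : 'M[R]_D)
    (A : 'M[R]_(D, K)) (e : 'rV[R]_K) :
  S \in unitmx -> top_eigenvectors S A e ->
  \tr (A^T *m invmx S *m A *m diag_mx e) = K%:R.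
Proof.
move=> Su [AA Ae _].
have SA : S *m A = A *m diag_mx e.
  apply/matrixP => i k; rewrite mul_mx_diag [RHS]mxE [LHS]mxE.
  have /matrixP/(_ i 0) := Ae k; rewrite !mxE mulrC => <-.
  by apply: eq_bigr => l _; rewrite mxE.
by rewrite -mulmxA -SA mulmxA mulmxKV// AA mxtrace1.
Qed.

Lemma exists_top_eigenvectors D K (S : 'M[R]_D) : S^T = S -> (K <= D)%N ->
  exists (A : 'M[R]_(D, K)) (e : 'rV[R]_K), top_eigenvectors S A e.
Proof.
move=> /sorted_spectral[U [d [UU SE dS]]] KD; pose w := widen_ord KD.
exists (colsub w U), (colsub w d); split.
- apply/matrixP => i j; have /matrixP/(_ (w i) (w j)) := UU.
  have wE : (w i == w j) = (i == j) by rewrite -!val_eqE.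
  rewrite !mxE wE => <-.
  by apply: eq_bigr => k _; rewrite !mxE.
- move=> k; have -> : col k (colsub w U) = col (w k) U.
    by apply/colP => i; rewrite !mxE.
  rewrite {1}SE [in LHS]colE -!mulmxA (mulmxA U^T) UU mul1mx.
  apply/colP => i; rewrite mulmxA mul_mx_diag -colE !mxE; exact: mulrC.
- exists [seq d 0 i | i : 'I_D]; split=> //.
    exact: (char_poly_spectral UU SE).
  rewrite -map_take (take_enum_widen KD) -map_comp.
  have -> : [seq colsub w d 0 k | k : 'I_K] =
      [seq (d 0 \o w) k | k <- enum 'I_K].
    by apply: eq_map => k; rewrite /= mxE.
  exact: perm_refl.
Qed.

End assembly.

Theorem proposition6 (R : realType) (D K : nat) (Sigma : 'M[R]_D)
    (P : probability 'cV[R]_D R) :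
  posdef Sigma -> is_gaussian P Sigma ->
  [/\ exists c : R,
        forall (A : 'M[R]_(D, K)) (V : 'M[R]_K) (Q : probability 'cV[R]_D R),
          admissible A V -> is_gaussian Q (A *m V *m A^T) ->
          qkl A Q P = (c - 2^-1 * (\sum_k ln (V k k))
                         + 2^-1 * \tr (A^T *m invmx Sigma *m A *m V))%:E,
      forall (A0 : 'M[R]_(D, K)) (e : 'rV[R]_K), top_eigenvectors Sigma A0 e ->
        admissible A0 (diag_mx e) /\
        forall (A : 'M[R]_(D, K)) (V : 'M[R]_K) (Q0 Q : probability 'cV[R]_D R),
          is_gaussian Q0 (A0 *m diag_mx e *m A0^T) ->
          admissible A V -> is_gaussian Q (A *m V *m A^T) ->
          (qkl A0 Q0 P <= qkl A Q P)%E
    & (K <= D)%N ->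
        exists (A0 : 'M[R]_(D, K)) (e : 'rV[R]_K), top_eigenvectors Sigma A0 e].
Proof.
move=> posS PG; have symS := posS.1.
have [U [d [UU SE dS]]] := sorted_spectral symS.
have d0 := posdef_spectral_gt0 posS UU SE.
have dle := sorted_ord_homo dS.
have formula := qkl_gaussian_formula (K := K) d0 UU SE PG.
have [Su _] := invmx_spectral d0 UU SE.
split.
- by eexists; exact: formula.
- move=> A0 e top; have adm0 := top_eigenvectors_admissible posS top.
  split=> // A V Q0 Q QG0 adm QG.
  rewrite (formula _ _ _ adm0 QG0) (formula _ _ _ adm QG) lee_fin.
  (* The constants cancel; at [A0] the trace is [K] and the logarithms are those of the top
     eigenvalues, so the bound of [objective_lower_bound] is attained. *)
  rewrite top_eigenvectors_trace//.
  rewrite (eq_bigr (fun k => ln (e 0 k))); last by move=> k _; rewrite mxE eqxx.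
  rewrite (top_eigenvectors_sum_ln UU SE dS top).
  have [V0 VE] := admissible_diag_gt0 adm; have [AA _ _] := adm.
  have := objective_lower_bound d0 dle UU SE AA V0.
  rewrite sumrB.
  have <- : \tr (A^T *m invmx Sigma *m A *m V) =
      \sum_k (A^T *m invmx Sigma *m A) k k * V k k.
    rewrite {1}VE mul_mx_diag /mxtrace.
    by apply: eq_bigr => k _; rewrite !mxE.
  lra.
- exact: exists_top_eigenvectors.
Qed.
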